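(* Let $X$ be a reflexive Banach space with an unconditional basis. Then there exist a Banach space $Y$ whose norm is $2R$ and which has a $1$-symmetric basis, and a $1$-complemented closed subspace $Z$ of $Y$ such that $X$ is isomorphic to $Z$. Moreover, $Z$ has a $1$-unconditional basis.
   Context: For $K\ge 1$, a basis $(e_n)$ is $K$-unconditional if $\|\sum_n \pm a_n e_n\|\le K\|\sum_n a_n e_n\|$ for all scalars $(a_n)$ and all choices of signs (unconditional if this holds for some $K$), and $K$-symmetric if $\|\sum_n \pm a_{\sigma(n)} e_n\|\le K\|\sum_n a_n e_n\|$ for all scalars $(a_n)$, all choices of signs and all permutations $\sigma$ of $\mathbb{N}$. A norm $\|\cdot\|$ on a Banach space $X$ is $2$-rotund ($2R$) if for every sequence $(x_n)\subset X$ with $\|x_n\|\le 1$ for all $n$ and $\lim_{m,n\to\infty}\|x_m+x_n\|=2$ there is $x\in X$ with $x_n\to x$ in norm. A closed subspace is $1$-complemented if it is the range of a linear projection of norm $1$ (or is trivial). ''Isomorphic'' means linearly homeomorphic. *)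

(* Defs.v *)
From HB Require Import structures.
From mathcomp Require Import all_boot all_order all_algebra.
From mathcomp Require Import all_classical all_reals all_analysis.

Set Implicit Arguments.
Unset Strict Implicit.
Unset Printing Implicit Defensive.

Import Order.TTheory GRing.Theory Num.Theory.
Import numFieldNormedType.Exports.

Local Open Scope classical_set_scope.
Local Open Scope ring_scope.

(* Partial sums of \sum_n a_n e_n. *)
Definition expansion (R : realType) (V : normedModType R)
    (a : nat -> R) (e : nat -> V) : nat -> V :=
  series (fun n => a n *: e n).

Definition closed_subspace (R : realType) (V : normedModType R)
    (Z : set V) : Prop :=
  [/\ closed Z, Z 0 & forall (a : R) (x y : V), Z x -> Z y -> Z (a *: x + y)].

(* (Schauder) bases are those of a closed subspace Z of V; a basis of the whole
   space is the case Z = setT. *)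
Definition schauder_basis (R : realType) (V : normedModType R)
    (Z : set V) (e : nat -> V) : Prop :=
  (forall n, Z (e n)) /\
  (forall x, Z x ->
     exists! a : nat -> R, expansion a e @ \oo --> x).

(* The inequality between norms of sums, for arbitrary scalars, is read with the
   convention that a divergent series has infinite norm: convergence of the
   right-hand series entails convergence of the left-hand one. *)
Definition unconditional_basis_with (R : realType) (K : R)
    (V : normedModType R) (Z : set V) (e : nat -> V) : Prop :=
  schauder_basis Z e /\
  forall (a : nat -> R) (s : nat -> bool),
    let b := fun n => (-1) ^+ s n * a n in
    cvgn (expansion a e) ->
    cvgn (expansion b e) /\
    `|limn (expansion b e)| <= K * `|limn (expansion a e)|.

Definition unconditional_basis (R : realType) (V : normedModType R)
    (Z : set V) (e : nat -> V) : Prop :=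
  exists2 K : R, 1 <= K & unconditional_basis_with K Z e.

Definition symmetric_basis_with (R : realType) (K : R)
    (V : normedModType R) (Z : set V) (e : nat -> V) : Prop :=
  schauder_basis Z e /\
  forall (a : nat -> R) (s : nat -> bool) (sigma : nat -> nat),
    bijective sigma ->
    let b := fun n => (-1) ^+ s n * a (sigma n) in
    cvgn (expansion a e) ->
    cvgn (expansion b e) /\
    `|limn (expansion b e)| <= K * `|limn (expansion a e)|.

(* The limit over m, n is the joint one, along the product filter. *)
Definition norm_2R (R : realType) (V : normedModType R) : Prop :=
  forall x : nat -> V,
    (forall n, `|x n| <= 1) ->
    (fun p : nat * nat => `|x p.1 + x p.2|) @ filter_prod \oo \oo --> (2 : R) ->
    exists l : V, x @ \oo --> l.

(* Takes the value +oo on unbounded linear maps. *)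
Definition opnorm (R : realType) (V W : normedModType R) (f : V -> W) : \bar R :=
  ereal_sup [set `|f x|%:E | x in [set x : V | `|x| <= 1]].

Definition one_complemented (R : realType) (V : normedModType R)
    (Z : set V) : Prop :=
  Z = [set 0] \/
  exists P : {linear V -> V},
    [/\ forall x, P (P x) = P x, range P = Z & opnorm P = 1%E].

Definition dual (R : realType) (V : normedModType R) : set (V -> R^o) :=
  [set f | linear f /\ continuous f].

(* Elements of the bidual, as functions whose values matter on dual V only. *)
Definition bidual (R : realType) (V : normedModType R) : set ((V -> R^o) -> R) :=
  [set Phi |
    (forall (a : R) (f g : V -> R^o), dual f -> dual g ->
       Phi (fun x => a *: f x + g x) = a * Phi f + Phi g) /\
    (exists C : R, forall f : V -> R^o, dual f ->
       (`|Phi f|%:E <= C%:E * opnorm f)%E)].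

Definition reflexive_space (R : realType) (V : normedModType R) : Prop :=
  forall Phi, bidual Phi ->
    exists x : V, forall f : V -> R^o, dual f -> Phi f = f x.

Definition isomorphic_onto (R : realType) (V W : normedModType R)
    (Z : set W) : Prop :=
  exists (T : {linear V -> W}) (S : W -> V),
    [/\ continuous T, range T = Z, cancel T S & {within Z, continuous S}].
Arguments norm_2R {R} V.
Arguments reflexive_space {R} V.
Arguments isomorphic_onto {R} V {W} Z.

(* Main.v *)
(* The symmetric space [Y] consists of the scalar sequences [y] for which [l2 y] is
   finite and the sequence of symmetric norms [kav y n = c_n K_n(y)], where [K_n] is
   the K-functional of (l_1, l_oo) at [4^(n^2+n)] and [c_n = 2^(-n^2)], belongs to
   [X], viewed as a Banach lattice of coefficient sequences.  A normalised indicator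
   [u_m] of a block of [4^(m^2+m)] consecutive integers satisfies [kav u_m m = 1],
   [kav u_m n <= 2^(-m-n)] for [n <> m], and [l2 u_m <= 2^(-m)]; hence the span of
   the [u_m] is a copy of [X], onto which averaging over the blocks projects with
   norm 1, as it does for every symmetric norm.

   The norm of [Y] is the l_2-sum of [l2] and of countably many lattice norms of
   [kav y].  If [|y_k + y_l| -> 2], the parallelogram defect of each summand tends to
   0; the Hilbertian summand makes [y_k] an l_2-Cauchy sequence, so that [kav y_k]
   converges coordinatewise.  The remaining summands, of Odell-Schlumprecht type
   [L (L a *: c + tail n |a|)] with [c] in a countable dense subset of the positive
   cone, force tails of [kav y_k] to have convex combinations as large as
   themselves along some subsequence.  As [X] is reflexive, bounded coordinatewise
   convergent sequences converge weakly, so by Mazur the tails of [kav y_k] are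
   asymptotically no larger than those of the limit, and [y_k] is Cauchy in [Y]. *)
Require Import Defs.
From HB Require Import structures.
From mathcomp Require Import all_boot all_order all_algebra.
From mathcomp Require Import all_classical all_reals all_analysis.
From mathcomp Require Import ring lra zify.

Set Implicit Arguments.
Unset Strict Implicit.
Unset Printing Implicit Defensive.

Import Order.TTheory GRing.Theory Num.Theory.
Import numFieldNormedType.Exports.

Local Open Scope classical_set_scope.
Local Open Scope ring_scope.

(** * Lattice seminorms with the Fatou property *)

(** Symmetry and rotundity pull in opposite directions: a 2R renorming of [X] works with tails,
    hence with the order of the basis, while the norm of [Y] must ignore the order of the
    coordinates. The way out is that [kav y] does not change when [y] is permuted or its signs are
    flipped, so that order-dependent lattice norms may be applied to [kav y]. The price is that
    [kav] is only subadditive: convergence of [kav y_k] says nothing about [kav (y_k - y_l)]. On a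
    tail one has to be content with [kav (y_k - y_l) <= kav y_k + kav y_l], which is enough once
    both tails are small; on a fixed head the l_2-norm decides. This is why the argument controls
    sizes of tails and never differences. The exponents are quadratic in the block index because
    ratios of neighbouring scales then decay in [n + m]. Linear exponents would give decay in
    [|n - m|] alone, whereas decay in [n + m] makes the off-diagonal interaction of the blocks
    bounded on any sequence space with normalised unit vectors. *)

Section FatouSeminorms.
Variable R : realType.
Implicit Types (a b : nat -> R) (D : set (nat -> R)) (q : (nat -> R) -> R).

(** [D] stands for the set where the seminorm is finite. Since [q] is real-valued and carries no
    information outside [D], each closure clause asserts membership in [D] together with its
    bound. *)
Record fatou_seminorm D q : Prop := FatouSeminorm {
  fs_dom0 : D 0;
  fs_ge0 : forall a, D a -> 0 <= q a;
  fs_ideal : forall a b, D a -> (forall i, `|b i| <= `|a i|) ->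
    D b /\ q b <= q a;
  fs_add : forall a b, D a -> D b -> D (a + b) /\ q (a + b) <= q a + q b;
  fs_scale : forall c a, D a -> D (c *: a) /\ q (c *: a) <= `|c| * q a;
  fs_fatou : forall (s : nat -> nat -> R) a C,
    (forall i, s k i @[k --> \oo] --> a i) ->
    (\forall k \near \oo, D (s k) /\ q (s k) <= C) -> D a /\ q a <= C }.

Section Theory.
Variables (D : set (nat -> R)) (q : (nat -> R) -> R).
Hypothesis fsq : fatou_seminorm D q.

Lemma fs_domP a b : D a -> (forall i, `|b i| <= `|a i|) -> D b.
Proof. by move=> Da /(fs_ideal fsq Da)[]. Qed.

Lemma fs_le a b : D a -> (forall i, `|b i| <= `|a i|) -> q b <= q a.
Proof. by move=> Da /(fs_ideal fsq Da)[]. Qed.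

Lemma fs_domD a b : D a -> D b -> D (a + b).
Proof. by move=> Da Db; case: (fs_add fsq Da Db). Qed.

Lemma fs_triangle a b : D a -> D b -> q (a + b) <= q a + q b.
Proof. by move=> Da Db; case: (fs_add fsq Da Db). Qed.

Lemma fs_domZ c a : D a -> D (c *: a).
Proof. by move=> Da; case: (fs_scale fsq c Da). Qed.

Lemma fs_domN a : D a -> D (- a).
Proof. by move=> Da; rewrite -scaleN1r; exact: fs_domZ. Qed.

Lemma fs_domB a b : D a -> D b -> D (a - b).
Proof. by move=> Da /fs_domN; exact: fs_domD. Qed.

Lemma fs_Z c a : D a -> q (c *: a) = `|c| * q a.
Proof.
move=> Da; apply/eqP; rewrite eq_le (fs_scale fsq c Da).2 /=.
have [->|c0] := eqVneq c 0.
  by rewrite normr0 mul0r (fs_ge0 fsq) //; exact: fs_domZ.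
have := (fs_scale fsq c^-1 (fs_domZ c Da)).2.
rewrite scalerA mulVf // scale1r normfV mulrC.
by rewrite ler_pdivlMr ?normr_gt0 // mulrC.
Qed.

Lemma fs_0 : q 0 = 0.
Proof. by rewrite -(scale0r 0) (fs_Z 0 (fs_dom0 fsq)) normr0 mul0r. Qed.

Lemma fs_N a : D a -> q (- a) = q a.
Proof. by move=> Da; rewrite -scaleN1r fs_Z // normrN1 mul1r. Qed.

Lemma fs_dist a b : D a -> D b -> q a - q b <= q (a - b).
Proof.
by move=> Da Db; rewrite lerBlDr -{1}(subrK b a) fs_triangle //; exact: fs_domB.
Qed.

Lemma fs_norm a : D a -> D (fun i => `|a i|) /\ q (fun i => `|a i|) = q a.
Proof.
move=> Da; have Dn : D (fun i => `|a i|) by apply: (fs_domP Da) => i; rewrite normr_id.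
split=> //; apply/eqP; rewrite eq_le !fs_le// => i; by rewrite normr_id.
Qed.

Lemma fs_sum (F : nat -> nat -> R) n : (forall i, D (F i)) ->
  D (\sum_(i < n) F i) /\ q (\sum_(i < n) F i) <= \sum_(i < n) q (F i).
Proof.
move=> DF; elim: n => [|n [Dn qn]]; first by rewrite !big_ord0 fs_0; split => //; exact: fs_dom0 fsq.
rewrite !big_ord_recr /=; split; first exact: fs_domD.
by rewrite (le_trans (fs_triangle Dn (DF n)))// lerD2r.
Qed.

Lemma fs_le_mono a b : D a -> (forall i, 0 <= b i) -> (forall i, b i <= a i) -> q b <= q a.
Proof.
by move=> Da b0 ba; apply: fs_le => // i; rewrite !ger0_norm// (le_trans (b0 i)).
Qed.

End Theory.

(** * Suprema of lattice seminorms *)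

Section Sup.
Variables (J : Type) (q : J -> (nat -> R) -> R) (i0 : J).
Hypothesis fsq : forall i, fatou_seminorm setT (q i).

Definition sup_dom : set (nat -> R) := [set a | exists C, forall i, q i a <= C].
Definition sup_fam a : R := sup (range (q^~ a)).

Lemma sup_fam_ub i a : sup_dom a -> q i a <= sup_fam a.
Proof.
move=> [C aC]; apply: ub_le_sup; last by exists i.
by exists C => _ [j _ <-].
Qed.

Lemma sup_fam_le a C : (forall i, q i a <= C) -> sup_dom a /\ sup_fam a <= C.
Proof.
move=> aC; split; first by exists C.
by apply: ge_sup => [|_ [i _ <-]//]; exists (q i0 a), i0.
Qed.

Lemma fatou_seminorm_sup : fatou_seminorm sup_dom sup_fam.
Proof.
split.
- by exists 0 => i; rewrite (fs_0 (fsq i)).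
- move=> a Da; apply: le_trans (sup_fam_ub i0 Da); exact: (fs_ge0 (fsq i0)).
- move=> a b Da ba; apply: sup_fam_le => i.
  by apply: le_trans (sup_fam_ub i Da); exact: (fs_le (fsq i)).
- move=> a b Da Db; apply: sup_fam_le => i.
  apply: (le_trans (fs_triangle (fsq i) (a:=a) (b:=b) I I)).
  by rewrite lerD ?sup_fam_ub.
- move=> c a Da; apply: sup_fam_le => i.
  by rewrite (fs_Z (fsq i))// ler_wpM2l// sup_fam_ub.
- move=> s a C sa sC; apply: sup_fam_le => i.
  apply: (fs_fatou (fsq i) sa _).2.
  apply: filterS sC => k [Dk kC]; split => //.
  exact: le_trans (sup_fam_ub _ Dk) kC.
Qed.

End Sup.

Lemma cvg_sum_ord n (s : nat -> nat -> R) a :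
  (forall i, s k i @[k --> \oo] --> a i) ->
  \sum_(i < n) s k i @[k --> \oo] --> \sum_(i < n) a i.
Proof.
move=> sa; elim: n => [|n IH].
  under eq_fun do rewrite big_ord0; rewrite big_ord0; exact: cvg_cst.
under eq_fun do rewrite big_ord_recr /=; rewrite big_ord_recr /=.
by apply: cvgD; [exact: IH|exact: sa].
Qed.

(** * The Euclidean norm and its parallelogram defect *)

Definition l2trunc n a := Num.sqrt (\sum_(i < n) a i ^+ 2).
Definition l2dom := sup_dom l2trunc.
Definition l2 a := sup_fam l2trunc a.

Lemma sumsq_ge0 n a : 0 <= \sum_(i < n) a i ^+ 2.
Proof. by apply: sumr_ge0 => i _; exact: sqr_ge0. Qed.

Lemma l2trunc_ge0 n a : 0 <= l2trunc n a. Proof. exact: sqrtr_ge0. Qed.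

Lemma sqr_l2trunc n a : l2trunc n a ^+ 2 = \sum_(i < n) a i ^+ 2.
Proof. by rewrite sqr_sqrtr // sumsq_ge0. Qed.

Lemma l2truncS n a : l2trunc n.+1 a = Num.sqrt (l2trunc n a ^+ 2 + a n ^+ 2).
Proof. by rewrite /l2trunc big_ord_recr /= sqr_sqrtr ?sumsq_ge0. Qed.

Lemma minkowski2 (f g a b : R) :
  Num.sqrt ((f + g) ^+ 2 + (a + b) ^+ 2) <=
  Num.sqrt (f ^+ 2 + a ^+ 2) + Num.sqrt (g ^+ 2 + b ^+ 2).
Proof.
have fa0 : 0 <= f ^+ 2 + a ^+ 2 by rewrite addr_ge0 ?sqr_ge0.
have gb0 : 0 <= g ^+ 2 + b ^+ 2 by rewrite addr_ge0 ?sqr_ge0.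
rewrite -(@ler_pXn2r _ 2%N)// ?nnegrE ?addr_ge0 ?sqrtr_ge0//.
rewrite sqr_sqrtr ?addr_ge0 ?sqr_ge0// [leRHS]sqrrD !sqr_sqrtr//.
have : f * g + a * b <= Num.sqrt (f ^+ 2 + a ^+ 2) * Num.sqrt (g ^+ 2 + b ^+ 2).
  rewrite -sqrtrM//; apply: le_trans (ler_norm _) _; rewrite -sqrtr_sqr.
  rewrite ler_wsqrtr//; have := sqr_ge0 (f * b - a * g); nra.
by move=> h; rewrite mulr2n; nra.
Qed.

Lemma fatou_seminorm_l2trunc n : fatou_seminorm setT (l2trunc n).
Proof.
split=> //.
- by move=> a _; exact: l2trunc_ge0.
- move=> a b _ ba; split=> //; rewrite ler_wsqrtr//; apply: ler_sum => i _.
  by rewrite -[leLHS]real_normK ?num_real// -[leRHS]real_normK ?num_real// lerXn2r ?nnegrE.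
- move=> a b _ _; split=> //; elim: n => [|n IH].
    by rewrite /l2trunc !big_ord0 sqrtr0 addr0.
  rewrite !l2truncS; apply: le_trans (minkowski2 _ _ _ _).
  by rewrite ler_wsqrtr// lerD2r lerXn2r ?nnegrE ?addr_ge0 ?l2trunc_ge0.
- move=> c a _; split=> //; rewrite /l2trunc -sqrtr_sqr -sqrtrM ?sqr_ge0// mulr_sumr.
  by under eq_bigr do rewrite exprMn.
- move=> s a C sa sC; split=> //.
  apply: (@cvgr_to_le _ \oo _ _ (fun k => l2trunc n (s k))); last first.
    by apply: filterS sC => k [].
  apply: continuous_cvg; first exact: sqrt_continuous.
  apply: (cvg_sum_ord (s := fun k i => s k i ^+ 2) (a := fun i => a i ^+ 2)) => i.
  by apply: cvgM; exact: sa.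
Qed.

Lemma fatou_seminorm_l2 : fatou_seminorm l2dom l2.
Proof. exact: (fatou_seminorm_sup 0%N fatou_seminorm_l2trunc). Qed.

Lemma l2trunc_le n a : l2dom a -> l2trunc n a <= l2 a.
Proof. exact: (sup_fam_ub (q:=l2trunc)). Qed.

Lemma l2_le a C : (forall n, l2trunc n a <= C) -> l2dom a /\ l2 a <= C.
Proof. exact: (sup_fam_le (q:=l2trunc) 0%N). Qed.

Lemma l2_coord a i : l2dom a -> `|a i| <= l2 a.
Proof.
move=> /(l2trunc_le i.+1); apply: le_trans.
by rewrite l2truncS -sqrtr_sqr ler_wsqrtr// lerDr sqr_ge0.
Qed.

Lemma l2trunc_le_sum n a : l2trunc n a <= \sum_(i < n) `|a i|.
Proof.
elim: n => [|n IH]; first by rewrite /l2trunc !big_ord0 sqrtr0.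
rewrite l2truncS big_ord_recr /=; apply: (@le_trans _ _ (l2trunc n a + `|a n|)); last first.
  by rewrite lerD2r.
rewrite -[leRHS]ger0_norm ?addr_ge0 ?l2trunc_ge0// -sqrtr_sqr ler_wsqrtr// sqrrD real_normK ?num_real//.
have := l2trunc_ge0 n a; have := normr_ge0 (a n); nra.
Qed.

Lemma sqr_l2_le a (x : R) : l2dom a -> (forall n, l2trunc n a ^+ 2 <= x) -> l2 a ^+ 2 <= x.
Proof.
move=> Da h; have x0 : 0 <= x by apply: le_trans (h 0%N); exact: sqr_ge0.
rewrite -[leRHS]sqr_sqrtr// lerXn2r ?nnegrE ?sqrtr_ge0 ?(fs_ge0 fatou_seminorm_l2)//.
apply: (l2_le _).2 => n.
by have := h n => /ler_wsqrtr; rewrite sqrtr_sqr ger0_norm ?l2trunc_ge0.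
Qed.

Lemma sqr_l2trunc_mono a m n : (m <= n)%N -> l2trunc m a ^+ 2 <= l2trunc n a ^+ 2.
Proof.
move=> mn; rewrite !sqr_l2trunc -!(big_mkord xpredT (fun i => a i ^+ 2)).
by rewrite (big_cat_nat (leq0n m) mn)//= lerDl sumr_ge0// => i _; exact: sqr_ge0.
Qed.

Lemma sqr_l2trunc_le n a : l2dom a -> l2trunc n a ^+ 2 <= l2 a ^+ 2.
Proof.
by move=> Da; rewrite lerXn2r ?nnegrE ?l2trunc_ge0 ?(fs_ge0 fatou_seminorm_l2)// l2trunc_le.
Qed.

Lemma l2_parallelogram a b : l2dom a -> l2dom b ->
  l2 (a - b) ^+ 2 + l2 (a + b) ^+ 2 <= 2 * l2 a ^+ 2 + 2 * l2 b ^+ 2.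
Proof.
move=> Da Db; have fs := fatou_seminorm_l2.
have Dab : l2dom (a - b) by exact: (fs_domB fs).
have Dab' : l2dom (a + b) by exact: (fs_domD fs).
set T := 2 * _ + _.
have T0 : 0 <= T by rewrite addr_ge0// mulr_ge0 ?sqr_ge0.
(* Separate truncation indices allow the two suprema to be taken one after the other; monotonicity
   in the index reduces to a common one, where the parallelogram identity is exact. *)
have key n m : l2trunc n (a - b) ^+ 2 + l2trunc m (a + b) ^+ 2 <= T.
  apply: (@le_trans _ _ (l2trunc (maxn n m) (a - b) ^+ 2 + l2trunc (maxn n m) (a + b) ^+ 2)).
    by rewrite lerD// sqr_l2trunc_mono// ?leq_maxl ?leq_maxr.
  rewrite (_ : _ + _ = 2 * l2trunc (maxn n m) a ^+ 2 + 2 * l2trunc (maxn n m) b ^+ 2).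
    by rewrite lerD// ler_wpM2l// sqr_l2trunc_le.
  rewrite !sqr_l2trunc -big_split/= !mulr_sumr -big_split/=.
  by apply: eq_bigr => i _; rewrite !fctE; ring.
have h2 n : l2trunc n (a - b) ^+ 2 + l2 (a + b) ^+ 2 <= T.
  by rewrite -lerBrDl sqr_l2_le// => m; rewrite lerBrDl.
by rewrite -lerBrDr sqr_l2_le// => n; rewrite lerBrDr.
Qed.

(** As [0 <= c i <= a i + b i], every coordinate contributes a nonnegative amount
    [2 * a i ^+ 2 + 2 * b i ^+ 2 - c i ^+ 2], so a single coordinate never exceeds the total. A
    small defect of an l_2-sum is thus inherited by each summand. *)
Lemma l2_defect (a b c : nat -> R) j : l2dom a -> l2dom b -> l2dom c ->
  (forall i, 0 <= c i <= a i + b i) ->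
  2 * a j ^+ 2 + 2 * b j ^+ 2 - c j ^+ 2 <= 2 * l2 a ^+ 2 + 2 * l2 b ^+ 2 - l2 c ^+ 2.
Proof.
move=> Da Db Dc cab; rewrite lerBrDr -lerBrDl; apply: sqr_l2_le => // n.
apply: le_trans (sqr_l2trunc_mono c (leq_maxl n j.+1)) _; set m := maxn _ _.
have jm : (j < m)%N by exact: leq_maxr.
have := sqr_l2trunc_le m Da; have := sqr_l2trunc_le m Db.
suff : 2 * a j ^+ 2 + 2 * b j ^+ 2 - c j ^+ 2 <=
    2 * l2trunc m a ^+ 2 + 2 * l2trunc m b ^+ 2 - l2trunc m c ^+ 2 by lra.
rewrite !sqr_l2trunc !mulr_sumr -big_split -sumrB/= (bigD1 (Ordinal jm))//= lerDl.
apply: sumr_ge0 => i _; have /andP[c0 c1] := cab i.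
have : c i ^+ 2 <= (a i + b i) ^+ 2 by rewrite lerXn2r ?nnegrE// (le_trans c0).
have := sqr_ge0 (a i - b i); nra.
Qed.

End FatouSeminorms.

(** * K-functionals, permutations and averaging *)

Section KFunctional.
Variable R : realType.
Implicit Types (a w : nat -> R) (N C : R).

Lemma ler_sum_nat_widen (F : nat -> R) m n : (m <= n)%N -> (forall i, 0 <= F i) ->
  \sum_(i < m) F i <= \sum_(i < n) F i.
Proof.
move=> mn F0; rewrite -!(big_mkord xpredT F) (big_cat_nat (leq0n m) mn)/=.
by rewrite lerDl sumr_ge0.
Qed.

Definition is_weight N w :=
  (forall i, 0 <= w i <= 1) /\ (forall m, \sum_(i < m) w i <= N).

Definition pairing N (p : {w | is_weight N w} * nat) a :=
  \sum_(i < p.2) sval p.1 i * `|a i|.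

(* [kfun N] is the K-functional of the couple (l_1, l_oo), written as a supremum
   of pairings in order to make averaging operators visibly contractive. *)
Definition kdom N := sup_dom (@pairing N).
Definition kfun N a := sup_fam (@pairing N) a.

Lemma is_weight0 N : 0 <= N -> is_weight N (fun=> 0).
Proof.
by move=> N0; split=> [i|m]; rewrite ?lexx ?ler01 ?big1.
Qed.

Definition weight0 N (N0 : 0 <= N) : {w | is_weight N w} := exist _ _ (is_weight0 N0).

Lemma fatou_seminorm_pairing N p : fatou_seminorm setT (@pairing N p).
Proof.
case: p => -[w [w01 wN]] n; rewrite /pairing /=.
have w0 i : 0 <= w i by case/andP: (w01 i).
split=> //.
- by move=> a _; apply: sumr_ge0 => i _; rewrite mulr_ge0.
- by move=> a b _ ba; split=> //; apply: ler_sum => i _; rewrite ler_wpM2l.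
- move=> a b _ _; split=> //; rewrite -big_split/=; apply: ler_sum => i _.
  by rewrite -mulrDr ler_wpM2l// ler_normD.
- move=> c a _; split=> //; rewrite mulr_sumr; apply: ler_sum => i _.
  by rewrite normrM mulrCA.
- move=> s a C sa sC; split=> //.
  apply: (@cvgr_to_le _ \oo _ _ (fun k => \sum_(i < n) w i * `|s k i|)); last first.
    by apply: filterS sC => k [].
  apply: (cvg_sum_ord (s := fun k i => w i * `|s k i|) (a := fun i => w i * `|a i|)) => i.
  by apply: cvgM; [exact: cvg_cst|apply: cvg_norm; exact: sa].
Qed.

Section Theory.
Variable (N : R).
Hypothesis N0 : 0 <= N.

Lemma fatou_seminorm_kfun : fatou_seminorm (kdom N) (kfun N).
Proof. exact: (fatou_seminorm_sup (weight0 N0, 0%N) (@fatou_seminorm_pairing N)). Qed.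

Lemma kfun_ub w m a : is_weight N w -> kdom N a -> \sum_(i < m) w i * `|a i| <= kfun N a.
Proof. by move=> ww; apply: (sup_fam_ub (q := @pairing N) (exist _ w ww, m)). Qed.

Lemma kfun_le a C : (forall w m, is_weight N w -> \sum_(i < m) w i * `|a i| <= C) ->
  kdom N a /\ kfun N a <= C.
Proof.
by move=> h; apply: (sup_fam_le (q := @pairing N) (weight0 N0, 0%N)) => -[[w ww] m]; exact: h.
Qed.

Lemma kfun_bounded a C : (forall i, `|a i| <= C) -> kdom N a /\ kfun N a <= N * C.
Proof.
move=> aC; apply: kfun_le => w m [w01 wN].
have C0 : 0 <= C by apply: le_trans (aC 0%N).
apply: (@le_trans _ _ (\sum_(i < m) w i * C)).
  by apply: ler_sum => i _; rewrite ler_wpM2l//; case/andP: (w01 i).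
by rewrite -mulr_suml ler_wpM2r.
Qed.

Lemma kdom_l2 a : l2dom a -> kdom N a.
Proof. by move=> Da; case: (@kfun_bounded a (l2 a)) => // i; exact: l2_coord. Qed.

Lemma kfun_l2 a : l2dom a -> kfun N a <= N * l2 a.
Proof. by move=> Da; case: (@kfun_bounded a (l2 a)) => // i; exact: l2_coord. Qed.

End Theory.
End KFunctional.

(** * Invariance under permutations *)

Section Permutation.
Variables (R : realType) (sg tau : nat -> nat).
Hypotheses (sgK : cancel sg tau) (tauK : cancel tau sg).

(** The first [m] indices have a bounded image under [sg], so a permuted partial sum is a masked
    ordinary one. Allowing every large [M] lets the caller enlarge the range to suit another
    truncation. *)
Lemma sum_ord_perm (F : nat -> R) m : exists M0, forall M, (M0 <= M)%N ->
  \sum_(i < m) F (sg i) = \sum_(j < M) (if (tau j < m)%N then F j else 0).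
Proof.
exists (\max_(i < m) sg i).+1 => M leM.
rewrite -(big_mkord xpredT (fun i => F (sg i))).
rewrite -(big_mkord xpredT (fun j => if (tau j < m)%N then F j else 0)) -big_mkcond /=.
rewrite /index_iota !subn0 -[LHS](big_map sg xpredT F) -[RHS]big_filter.
apply: perm_big; apply: uniq_perm.
- by rewrite map_inj_uniq ?iota_uniq//; exact: can_inj sgK.
- by rewrite filter_uniq// iota_uniq.
move=> j; rewrite mem_filter mem_iota /= add0n.
apply/mapP/andP => [[i]|[jm jM]].
  rewrite mem_iota /= add0n => im ->; rewrite sgK; split=> //.
  apply: leq_trans leM; rewrite ltnS; exact: (leq_bigmax (Ordinal im)).
by exists (tau j); rewrite ?mem_iota ?tauK.
Qed.

Lemma l2_perm (a : nat -> R) : l2dom a -> l2dom (a \o sg) /\ l2 (a \o sg) <= l2 a.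
Proof.
move=> Da; apply: l2_le => n; have [M0 /(_ M0 (leqnn _)) h] := sum_ord_perm (fun i => a i ^+ 2) n.
rewrite /l2trunc [X in Num.sqrt X]h; apply: le_trans (l2trunc_le M0 Da); rewrite ler_wsqrtr//.
by apply: ler_sum => j _; case: ifP => // _; exact: sqr_ge0.
Qed.

Lemma kfun_perm (N : R) (a : nat -> R) : 0 <= N -> kdom N a ->
  kdom N (a \o sg) /\ kfun N (a \o sg) <= kfun N a.
Proof.
move=> N0 Da; apply: kfun_le => // w m [w01 wN].
(* The weight transported by the permutation, cut off so that its total mass is that of the first
   [m] values of [w]. *)
pose w' j := if (tau j < m)%N then w (tau j) else 0.
have w'0 j : 0 <= w' j by rewrite /w'; case: ifP => // _; case/andP: (w01 (tau j)).
have w'w : is_weight N w'.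
  split=> [j|M].
    by rewrite w'0/= /w'; case: ifP => _; rewrite ?ler01//; case/andP: (w01 (tau j)).
  have [M0 h] := sum_ord_perm (w \o tau) m.
  have := h (maxn M M0) (leq_maxr _ _); under eq_bigr do rewrite /= sgK.
  move=> E; apply: le_trans (wN m); rewrite E.
  exact: (ler_sum_nat_widen (leq_maxl _ _)).
have [M0 /(_ M0 (leqnn _)) h] := sum_ord_perm (fun j => w (tau j) * `|a j|) m.
rewrite (_ : \sum_(i < m) _ = \sum_(i < m) w (tau (sg i)) * `|a (sg i)|); last first.
  by apply: eq_bigr => i _; rewrite sgK.
rewrite h.
apply: le_trans (kfun_ub M0 w'w Da); apply: ler_sum => j _.
by rewrite /w'; case: ifP => // _; rewrite mul0r.
Qed.

End Permutation.

(** * Consecutive blocks and averaging over them *)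

Section Blocks.
Variables (R : realType) (size : nat -> nat).
Hypothesis size_gt0 : forall m, (0 < size m)%N.
Implicit Types (a w f g : nat -> R).

Definition start m := (\sum_(i < m) size i)%N.

Lemma startS m : start m.+1 = (start m + size m)%N.
Proof. by rewrite /start big_ord_recr. Qed.

Lemma start_lt m : (start m < start m.+1)%N.
Proof. by rewrite startS -[ltnLHS]addn0 ltn_add2l. Qed.

Lemma leq_start m n : (m <= n)%N -> (start m <= start n)%N.
Proof.
move=> mn; rewrite -(subnKC mn); elim: (n - m)%N => [|k IH]; first by rewrite addn0.
by rewrite addnS (leq_trans IH)// ltnW// start_lt.
Qed.

Lemma leq_id_start m : (m <= start m)%N.
Proof. by elim: m => [//|m IH]; rewrite (leq_ltn_trans IH)// start_lt. Qed.

Lemma block_ex i : exists m, (i < start m.+1)%N.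
Proof. by exists i; exact: leq_id_start i.+1. Qed.

Definition block i := ex_minn (block_ex i).

Lemma blockP i : (start (block i) <= i < start (block i).+1)%N.
Proof.
rewrite /block; case: ex_minnP => m im mmin; rewrite im andbT.
case: m im mmin => [|m] im mmin; first by rewrite /start big_ord0.
by rewrite leqNgt; apply/negP => /mmin; rewrite ltnn.
Qed.

Lemma block_eq i m : (start m <= i < start m.+1)%N -> block i = m.
Proof.
move=> /andP[mi im]; have /andP[bi ib] := blockP i.
apply/eqP; rewrite eqn_leq; apply/andP; split; rewrite leqNgt; apply/negP => h.
  by have := leq_trans im (leq_trans (leq_start h) bi); rewrite ltnn.
by have := leq_trans ib (leq_trans (leq_start h) mi); rewrite ltnn.
Qed.

Lemma block_start m : block (start m) = m.
Proof. by apply: block_eq; rewrite leqnn start_lt. Qed.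

Lemma sum_blocks (F : nat -> R) k :
  \sum_(i < start k) F i = \sum_(m < k) \sum_(start m <= i < start m.+1) F i.
Proof.
rewrite -(big_mkord xpredT F); elim: k => [|k IH].
  by rewrite big_ord0 /start big_ord0 big_geq.
rewrite big_ord_recr/= -IH.
by rewrite (big_cat_nat (leq0n (start k)) (ltnW (start_lt k))).
Qed.

Definition blocksum a m := \sum_(start m <= i < start m.+1) a i.
Definition avg a i := blocksum a (block i) / (size (block i))%:R.

Lemma size_neq0 m : (size m)%:R != 0 :> R.
Proof. by rewrite pnatr_eq0 -lt0n. Qed.

Lemma sum_block_const (F : nat -> R) c m : (forall i, block i = m -> F i = c) ->
  \sum_(start m <= i < start m.+1) F i = (size m)%:R * c.
Proof.
move=> Fc; rewrite (eq_big_nat _ _ (F2 := fun=> c)); last first.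
  by move=> i im; rewrite Fc//; exact: block_eq.
by rewrite sumr_const_nat startS addKn mulr_natl.
Qed.

Lemma avg_const a : (forall i, a i = a (start (block i))) -> avg a = a.
Proof.
move=> ac; apply/funext => i; rewrite /avg /blocksum.
rewrite (sum_block_const (c := a i)).
  by rewrite mulrC mulKf// size_neq0.
by move=> j ji; rewrite ac ji -ac.
Qed.

Lemma avg_start a i : avg a i = avg a (start (block i)).
Proof. by rewrite /avg block_start. Qed.

Lemma avg_idem a : avg (avg a) = avg a.
Proof. by apply: avg_const => i; exact: avg_start. Qed.

(** Both sides are the sum over [m < k] of [blocksum f m * blocksum g m / size m]. The range ends at
    a block boundary so that no block is cut. This moves the averaging from a vector onto the weight
    it is tested against. *)
Lemma avg_selfadjoint f g k :
  \sum_(i < start k) f i * avg g i = \sum_(i < start k) avg f i * g i.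
Proof.
rewrite (sum_blocks (fun i => f i * avg g i)) (sum_blocks (fun i => avg f i * g i)).
apply: eq_bigr => m _.
rewrite (eq_big_nat _ _ (F2 := fun i => f i * (blocksum g m / (size m)%:R))); last first.
  by move=> i /block_eq im; rewrite /avg im.
rewrite [RHS](eq_big_nat _ _ (F2 := fun i => (blocksum f m / (size m)%:R) * g i)); last first.
  by move=> i /block_eq im; rewrite /avg im.
by rewrite -mulr_suml -mulr_sumr -/(blocksum f m) -/(blocksum g m); ring.
Qed.

Lemma avg_ge0 a : (forall i, 0 <= a i) -> forall i, 0 <= avg a i.
Proof. by move=> a0 i; rewrite /avg divr_ge0// sumr_ge0. Qed.

Lemma avg_le a b i : (forall i, a i <= b i) -> avg a i <= avg b i.
Proof. by move=> ab; rewrite /avg ler_wpM2r ?invr_ge0// ler_sum. Qed.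

Lemma norm_avg a i : `|avg a i| <= avg (fun i => `|a i|) i.
Proof.
rewrite /avg normrM normfV (@ger0_norm _ (_ %:R))// ler_wpM2r ?invr_ge0//.
exact: ler_norm_sum.
Qed.

(** Averaging is an orthogonal projection: on complete blocks, the squared norms of [a] and [avg a]
    differ by that of [a - avg a]. *)
Lemma l2_avg a : l2dom a -> l2dom (avg a) /\ l2 (avg a) <= l2 a.
Proof.
move=> Da; apply: l2_le => n; apply: le_trans (l2trunc_le (start n) Da).
apply: (@le_trans _ _ (l2trunc (start n) (avg a))).
  rewrite ler_wsqrtr// (ler_sum_nat_widen (F := fun i => avg a i ^+ 2))// ?leq_id_start// => i.
  exact: sqr_ge0.
rewrite ler_wsqrtr//.
have E : \sum_(i < start n) avg a i ^+ 2 = \sum_(i < start n) avg a i * a i.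
  by rewrite -[in RHS]avg_idem -avg_selfadjoint.
rewrite -subr_ge0; have -> : \sum_(i < start n) a i ^+ 2 - \sum_(i < start n) avg a i ^+ 2
    = \sum_(i < start n) (a i - avg a i) ^+ 2.
  transitivity (\sum_(i < start n) a i ^+ 2 - 2 * \sum_(i < start n) avg a i * a i
    + \sum_(i < start n) avg a i ^+ 2); first by rewrite E; ring.
  rewrite mulr_sumr -sumrB -big_split/=; apply: eq_bigr => i _; ring.
by apply: sumr_ge0 => i _; exact: sqr_ge0.
Qed.

(** The average of an admissible weight is admissible: its values stay in the unit interval, its
    mass over complete blocks is unchanged, and self-adjointness does the rest. *)
Lemma kfun_avg (N : R) a : 0 <= N -> kdom N a -> kdom N (avg a) /\ kfun N (avg a) <= kfun N a.
Proof.
move=> N0 Da; apply: kfun_le => // w m [w01 wN].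
have w0 i : 0 <= w i by case/andP: (w01 i).
have avg1 : avg (fun=> 1 : R) = fun=> 1 by apply: avg_const.
apply: (@le_trans _ _ (\sum_(i < start m) avg w i * `|a i|)).
  rewrite -(avg_selfadjoint w (fun i => `|a i|)).
  apply: (@le_trans _ _ (\sum_(i < start m) w i * `|avg a i|)).
    apply: (ler_sum_nat_widen (F := fun i => w i * `|avg a i|)); first exact: leq_id_start.
    by move=> i; rewrite mulr_ge0.
  by apply: ler_sum => i _; rewrite ler_wpM2l// norm_avg.
apply: kfun_ub => //; split=> [i|M].
  rewrite avg_ge0//= (le_trans (avg_le i (b := fun=> 1) _))//; last by rewrite avg1.
  by move=> j; case/andP: (w01 j).
apply: le_trans (wN (start M)).
apply: (@le_trans _ _ (\sum_(i < start M) avg w i)).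
  by apply: ler_sum_nat_widen; [exact: leq_id_start|exact: avg_ge0].
under eq_bigr do rewrite -[avg w _]mulr1.
rewrite -(avg_selfadjoint w (fun=> 1)) avg1.
by under eq_bigr do rewrite mulr1.
Qed.

Definition blockvec (m : nat) (i : nat) : R := (block i == m)%:R.

Lemma sum_blockvec (F : nat -> R) m k : (forall i, 0 <= F i) ->
  \sum_(i < k) F i * blockvec m i <= \sum_(start m <= i < start m.+1) F i.
Proof.
move=> F0; have F0' i : 0 <= F i * blockvec m i by rewrite mulr_ge0.
apply: (@le_trans _ _ (\sum_(i < start (maxn k m.+1)) F i * blockvec m i)).
  apply: (ler_sum_nat_widen (F := fun i => F i * blockvec m i)) => //.
  by rewrite (leq_trans (leq_maxl k m.+1))// leq_id_start.
rewrite (sum_blocks (fun i => F i * blockvec m i)).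
rewrite (bigD1 (Ordinal (leq_maxr k m.+1)))//= [X in _ + X]big1 ?addr0.
  rewrite le_eqVlt; apply/orP; left; apply/eqP/eq_big_nat => i /block_eq im.
  by rewrite /blockvec im eqxx mulr1.
move=> j jm; rewrite big_nat_cond big1// => i; rewrite andbT => /block_eq ij.
rewrite /blockvec ij; case: eqP => [jm'|]; last by rewrite mulr0.
by case/eqP: jm; apply: val_inj.
Qed.

Lemma l2_blockvec m : l2dom (blockvec m) /\ l2 (blockvec m) <= Num.sqrt (size m)%:R.
Proof.
apply: l2_le => n; rewrite ler_wsqrtr//.
apply: (le_trans _ (le_trans (sum_blockvec m n (F := fun=> 1) (fun=> ler01)) _)).
  by apply: ler_sum => i _; rewrite /blockvec; case: eqP => _; rewrite ?expr0n ?expr1n ?mul1r.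
by rewrite (sum_block_const (c:=1))// mulr1.
Qed.

(** This bound uses that weights are at most 1, [kfun_blockvec] that their mass is at most [N].
    Estimates between different blocks use whichever is smaller. *)
Lemma kfun_blockvec_size (N : R) m : 0 <= N -> kfun N (blockvec m) <= (size m)%:R.
Proof.
move=> N0; apply: (kfun_le N0 _).2 => w n [w01 wN].
rewrite -[leRHS]mulr1 -(sum_block_const (F := fun=> 1) (m := m))//.
apply: le_trans (sum_blockvec m n (F := fun=> 1) (fun=> ler01)); apply: ler_sum => i _.
by rewrite ger0_norm ?ler0n// ler_wpM2r ?ler0n//; case/andP: (w01 i).
Qed.

Lemma kfun_blockvec (N : R) m : 0 <= N -> kfun N (blockvec m) <= N.
Proof.
move=> N0; rewrite -[leRHS]mulr1; apply: (kfun_bounded N0 _).2 => i.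
by rewrite /blockvec; case: eqP => _; rewrite ?normr0 ?normr1.
Qed.

(** The indicator of block [m] is itself an admissible weight, of mass exactly [size m]. This lower
    bound recovers coefficients from [kav] without loss of a constant. *)
Lemma kfun_block_ge a m : kdom (size m)%:R a ->
  (forall i, block i = m -> a i = a (start m)) ->
  (size m)%:R * `|a (start m)| <= kfun (size m)%:R a.
Proof.
move=> Da ac; have w : is_weight (size m)%:R (blockvec m).
  split=> [i|n]; first by rewrite /blockvec; case: eqP => _; rewrite ?lexx ?ler01.
  apply: (le_trans _ (le_trans (sum_blockvec m n (F := fun=> 1) (fun=> ler01)) _)).
    by apply: ler_sum => i _; rewrite mul1r.
  by rewrite (sum_block_const (c:=1))// mulr1.
apply: le_trans (kfun_ub (start m.+1) w Da).
rewrite (sum_blocks (fun i => blockvec m i * `|a i|)) big_ord_recr/=.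
rewrite (sum_block_const (m := m) (c := `|a (start m)|)).
  by rewrite lerDr sumr_ge0// => j _; rewrite sumr_ge0// => i _; rewrite mulr_ge0.
by move=> i im; rewrite /blockvec im eqxx mul1r ac.
Qed.

End Blocks.

(** * Types on a sequence space *)

Section CauchySequences.
Variable R : realType.

Lemma half_gt0 (e : R) : 0 < e -> 0 < e / 2.
Proof. by move=> e0; rewrite divr_gt0. Qed.

Lemma cauchy_seq_cvgn (V : completeNormedModType R) (u : nat -> V) :
  (forall e : R, 0 < e -> exists K, forall k l, (K <= k)%N -> (K <= l)%N -> `|u k - u l| <= e) ->
  cvgn u.
Proof.
move=> cu; apply: cauchy_cvg; apply: cauchy_exP => e e0.
have [K hK] := cu (e / 2) (half_gt0 e0).
exists (u K); exists K => // k /= Kk; rewrite -ball_normE /=.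
by rewrite (le_lt_trans (hK _ _ (leqnn K) Kk))// ltr_pdivrMr// ltr_pMr// ltr1n.
Qed.

Lemma near_ooP (P : nat -> Prop) :
  (\forall k \near \oo, P k) <-> exists K, forall k, (K <= k)%N -> P k.
Proof. by split => [[K _ h]|[K h]]; exists K. Qed.

Lemma cvgn_distP (V : normedModType R) (u : nat -> V) l :
  (u @ \oo --> l) <-> (forall e : R, 0 < e -> exists K, forall k, (K <= k)%N -> `|u k - l| <= e).
Proof.
split=> [/cvgrPdist_le h e /h /near_ooP[K hK]|h].
  by exists K => k /hK; rewrite distrC.
by apply/cvgrPdist_le => e /h [K hK]; apply/near_ooP; exists K => k /hK; rewrite distrC.
Qed.

End CauchySequences.

Section SequenceSpaces.
Variable R : realType.
Implicit Types (a b c : nat -> R).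

Definition unitvec (i j : nat) : R := (j == i)%:R.
Definition head n a (i : nat) : R := if (i < n)%N then a i else 0.
Definition tail n a (i : nat) : R := if (i < n)%N then 0 else a i.

Lemma head_tail n a : a = head n a + tail n a.
Proof. by apply/funext => i; rewrite fctE /head /tail; case: ifP; rewrite ?addr0 ?add0r. Qed.

Lemma headE n a : head n a = \sum_(i < n) a i *: unitvec i.
Proof.
apply/funext => j; rewrite fct_sumE /head; case: ltnP => jn.
  rewrite (bigD1 (Ordinal jn))//= big1 ?addr0.
    by rewrite fctE /unitvec eqxx /GRing.scale/= mulr1.
  move=> i ij; rewrite fctE /unitvec; case: eqP => [E|]; last by rewrite /GRing.scale/= mulr0.
  by case/eqP: ij; apply: val_inj.
rewrite big1// => i _; rewrite fctE /unitvec; case: eqP => [E|]; last by rewrite /GRing.scale/= mulr0.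
by move: (ltn_ord i); rewrite -E ltnNge jn.
Qed.

Lemma norm_tail_le n a i : `|tail n a i| <= `|a i|.
Proof. by rewrite /tail; case: ifP => // _; rewrite normr0. Qed.

Lemma tail_ge0 n a : (forall i, 0 <= a i) -> forall i, 0 <= tail n a i.
Proof. by move=> a0 i; rewrite /tail; case: ifP. Qed.

(* [ss_mazur] is what reflexivity contributes; it combines the weak convergence of
   bounded coordinatewise convergent sequences with Mazur's lemma. *)
Record seq_space (E : set (nat -> R)) (L : (nat -> R) -> R) : Prop := SeqSpace {
  ss_fs :> fatou_seminorm E L;
  ss_coord : forall a i, E a -> `|a i| <= L a;
  ss_unit : forall i, E (unitvec i) /\ L (unitvec i) <= 1;
  ss_tail : forall a, E a -> L (tail n a) @[n --> \oo] --> 0;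
  ss_mazur : forall (w_ : nat -> nat -> R) w C d,
    (forall k, E (w_ k) /\ L (w_ k) <= C) ->
    (forall i, w_ k i @[k --> \oo] --> w i) ->
    (forall r (lam : nat -> R), (forall i, 0 <= lam i) -> \sum_(i < r) lam i = 1 ->
       d <= L (\sum_(i < r) lam i *: w_ i)) ->
    d <= L w }.

Section Theory.
Variables (E : set (nat -> R)) (L : (nat -> R) -> R).
Hypothesis EL : seq_space E L.
Let fs : fatou_seminorm E L := EL.

Lemma ss_head n a : E (head n a) /\ L (head n a) <= \sum_(i < n) `|a i|.
Proof.
rewrite headE; have Eu i : E (a i *: unitvec i) by apply: (fs_domZ fs); case: (ss_unit EL i).
have [? h] := fs_sum fs n Eu; split=> //; apply: le_trans h _; apply: ler_sum => i _.
by have [Ei Li] := ss_unit EL i; rewrite (fs_Z fs)// ler_piMr.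
Qed.

Lemma ss_domtail n a : E a -> E (tail n a).
Proof. by move=> Ea; apply: (fs_domP fs Ea) => i; exact: norm_tail_le. Qed.

Lemma ss_tail_le n a : E a -> L (tail n a) <= L a.
Proof. by move=> Ea; apply: (fs_le fs Ea) => i; exact: norm_tail_le. Qed.

Lemma ss_le_head_tail n a : E a -> L a <= \sum_(i < n) `|a i| + L (tail n a).
Proof.
move=> Ea; rewrite {1}(head_tail n a); have [Eh Lh] := ss_head n a.
by rewrite (le_trans (fs_triangle fs Eh (ss_domtail n Ea)))// lerD2r.
Qed.

Lemma ss_tails_cvg0 (s : nat -> nat -> R) : (forall k, E (s k)) ->
  (forall i, s k i @[k --> \oo] --> 0) ->
  (forall e : R, 0 < e -> exists n, \forall k \near \oo, L (tail n (s k)) <= e) ->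
  L (s k) @[k --> \oo] --> 0.
Proof.
move=> Es s0 tl; apply/cvgr0Pnorm_le => e e0.
have [n hn] := tl (e / 2) (half_gt0 e0).
have sum0 : \sum_(i < n) `|s k i| @[k --> \oo] --> 0.
  have := @cvg_sum_ord R n (fun k i => `|s k i|) (fun=> 0).
  by rewrite big1//; apply => i; rewrite -(normr0 R); apply: cvg_norm; exact: s0.
have /cvgr0Pnorm_le/(_ (e / 2) (half_gt0 e0)) h := sum0.
apply: filterS2 hn h => k h1 h2.
rewrite ger0_norm ?(fs_ge0 fs)//; apply: le_trans (ss_le_head_tail n (Es k)) _.
by rewrite [leRHS]splitr lerD// (le_trans (ler_norm _)).
Qed.

(** Order continuity: the tails of [a] are small and dominate those of all [s k] at once. *)
Lemma ss_dominated_cvg0 (s : nat -> nat -> R) a : E a -> (forall k i, `|s k i| <= `|a i|) ->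
  (forall i, s k i @[k --> \oo] --> 0) -> L (s k) @[k --> \oo] --> 0.
Proof.
move=> Ea sa s0; apply: ss_tails_cvg0 => //.
  by move=> k; apply: (fs_domP fs Ea) => i.
move=> e e0; have /cvgr0Pnorm_le/(_ e e0) /near_ooP[n hn] := ss_tail EL Ea.
exists n; apply: nearW => k; apply: le_trans (le_trans (ler_norm _) (hn n (leqnn n))).
apply: (fs_le fs (ss_domtail n Ea)) => i; rewrite /tail; case: ifP => // _.
Qed.

(** * Types and lower l_1-estimates *)

Section Types.
Variables (w_ : nat -> nat -> R) (w : nat -> R) (C : R).
Hypothesis w_E : forall k, E (w_ k) /\ L (w_ k) <= C.
Hypothesis w_ge0 : forall k i, 0 <= w_ k i.
Hypothesis w_cvg : forall i, w_ k i @[k --> \oo] --> w i.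
(** Asymptotically, the midpoint of [c + w_k] and [c + w_l] is as long as its endpoints, for every
    positive [c]. This is the trace of the 2R condition on which the whole section rests. *)
Hypothesis w_add : forall c, E c -> (forall i, 0 <= c i) -> forall e : R, 0 < e ->
  exists K, forall k l, (K <= k)%N -> (K <= l)%N ->
  `|L (c + w_ k) - L (c + w_ l)| <= e /\
  L (c + w_ k) + L (c + w_ l) - e <= L (2%:R *: c + w_ k + w_ l).

Definition typ c := limn (fun k => L (c + w_ k)).

Let Ew k : E (w_ k). Proof. by case: (w_E k). Qed.

Lemma typ_cvg c : E c -> (forall i, 0 <= c i) -> L (c + w_ k) @[k --> \oo] --> typ c.
Proof.
move=> Ec c0; apply: cauchy_seq_cvgn => e /(w_add Ec c0)[K hK].
by exists K => k l Kk Kl; case: (hK k l Kk Kl).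
Qed.

Lemma typ_dist c (e : R) : E c -> (forall i, 0 <= c i) -> 0 < e ->
  exists K, forall k, (K <= k)%N -> `|L (c + w_ k) - typ c| <= e.
Proof. by move=> Ec c0; have /cvgn_distP := typ_cvg Ec c0; apply. Qed.

Lemma typ_mono c c' : E c' -> (forall i, 0 <= c i) -> (forall i, c i <= c' i) -> typ c <= typ c'.
Proof.
move=> Ec' c0 cc'; have Ec : E c.
  by apply: (fs_domP fs Ec') => i; rewrite !ger0_norm// (le_trans (c0 i)).
have c'0 i : 0 <= c' i by rewrite (le_trans (c0 i)).
apply: ler_lim; first by apply: cvgP; exact: typ_cvg.
  by apply: cvgP; exact: typ_cvg.
apply: nearW => k; apply: (fs_le_mono fs); first exact: (fs_domD fs).
  by move=> i; rewrite fctE addr_ge0.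
by move=> i; rewrite !fctE lerD2r.
Qed.

Lemma typ_le c : E c -> (forall i, 0 <= c i) -> typ c <= L c + typ 0.
Proof.
move=> Ec c0; have E0 := fs_dom0 fs.
have h0 : L (0 + w_ k) @[k --> \oo] --> typ 0 by apply: typ_cvg => // i; rewrite fctE.
have h1 : L c + L (0 + w_ k) @[k --> \oo] --> L c + typ 0 by apply: cvgD => //; exact: cvg_cst.
rewrite -(cvg_lim _ h1)//; apply: ler_lim; first by apply: cvgP; exact: typ_cvg.
  by apply: cvgP h1.
by apply: nearW => k; rewrite add0r (fs_triangle fs).
Qed.

(* [d + t w_k + (1-t) w_l] and its mirror image add up to [2d + w_k + w_l],
   and both have norm at most about [typ d]. *)
Lemma typ_convex c (t e : R) : E c -> (forall i, 0 <= c i) -> 0 <= t <= 1 -> 0 < e ->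
  exists K, forall k l, (K <= k)%N -> (K <= l)%N ->
  typ c - e <= L (c + t *: w_ k + (1 - t) *: w_ l).
Proof.
move=> Ec c0 /andP[t0 t1] e0; have e4 : 0 < e / 4%:R by rewrite divr_gt0// ltr0n.
have [K1 h1] := w_add Ec c0 e4; have [K2 h2] := typ_dist Ec c0 e4.
exists (maxn K1 K2) => k l; rewrite !geq_max => /andP[k1 k2] /andP[l1 l2].
have [_ h] := h1 k l k1 l1; move: (h2 k k2) (h2 l l2); rewrite !ler_norml => /andP[k3 k4] /andP[l3 l4].
have s0 : 0 <= 1 - t by rewrite subr_ge0.
set u := c + _ + _; pose u' := (1 - t) *: (c + w_ k) + t *: (c + w_ l).
have Eck j : E (c + w_ j) by exact: (fs_domD fs).
have Eu : E u by apply: (fs_domD fs); [apply: (fs_domD fs) => //|]; exact: (fs_domZ fs).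
have Eu' : E u' by apply: (fs_domD fs); exact: (fs_domZ fs).
have uu' : 2%:R *: c + w_ k + w_ l = u + u'.
  by apply/funext => i; rewrite /u /u' !fctE /GRing.scale/=; ring.
have := fs_triangle fs Eu Eu'; rewrite -uu'.
have Lu' : L u' <= (1 - t) * L (c + w_ k) + t * L (c + w_ l).
  apply: (le_trans (fs_triangle fs (fs_domZ fs _ (Eck k)) (fs_domZ fs _ (Eck l)))).
  by rewrite !(fs_Z fs)// !ger0_norm.
nra.
Qed.

(** With [d = (1 + b)^-1 *: c] and [t = b / (1 + b)], the vector [c + b *: w_k + w_l] is [1 + b]
    times [d + t *: w_k + (1 - t) *: w_l], to which [typ_convex] applies; then [l] tends to
    infinity. A term [b *: w_k] is thereby absorbed into the term hidden in the type. *)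
Lemma typ_merge c (b e : R) : E c -> (forall i, 0 <= c i) -> 0 <= b -> 0 < e ->
  exists K, forall k, (K <= k)%N ->
  (1 + b) * typ ((1 + b)^-1 *: c) - e <= typ (c + b *: w_ k).
Proof.
move=> Ec c0 b0 e0; have b1 : 0 < 1 + b by rewrite ltr_pwDl.
pose d := (1 + b)^-1 *: c; pose t := b / (1 + b).
have Ed : E d by exact: (fs_domZ fs).
have d0 i : 0 <= d i by rewrite /d fctE mulr_ge0// invr_ge0 ltW.
have t01 : 0 <= t <= 1.
  by rewrite divr_ge0 ?(ltW b1)//= ler_pdivrMr// mul1r lerDr.
have [K hK] := typ_convex Ed d0 t01 (divr_gt0 e0 b1).
exists K => k Kk; have Ecw : E (c + b *: w_ k) by apply: (fs_domD fs) => //; exact: (fs_domZ fs).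
apply: limr_ge.
  by apply: cvgP (typ_cvg Ecw _) => i; rewrite fctE addr_ge0// fctE mulr_ge0.
apply/near_ooP; exists K => l Kl; have := hK k l Kk Kl.
have -> : c + b *: w_ k + w_ l = (1 + b) *: (d + t *: w_ k + (1 - t) *: w_ l).
  apply/funext => i; rewrite /d /t !fctE /GRing.scale/=; field; exact: lt0r_neq0.
rewrite (fs_Z fs); last first.
  by apply: (fs_domD fs); [apply: (fs_domD fs) => //|]; exact: (fs_domZ fs).
rewrite (ger0_norm (ltW b1)) -(ler_pM2l b1) mulrBr.
by rewrite (mulrC _ (e / _)) divfK// lt0r_neq0.
Qed.

Definition comb (lam : nat -> R) (ks : seq nat) : nat -> R :=
  \sum_(i < size ks) lam i *: w_ (nth 0%N ks i).

(** A lower l_1-estimate for the chosen vectors together with one further [w_l], [l] going to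
    infinity, whose coefficient is the summand 1. *)
Definition l1_block (d : R) (ks : seq nat) :=
  forall lam : nat -> R, (forall i, 0 <= lam i <= 1) ->
  d * (1 + \sum_(i < size ks) lam i) <= typ (comb lam ks).

Lemma comb_dom lam ks : E (comb lam ks).
Proof. have h i : E (lam i *: w_ (nth 0%N ks i)) by exact: (fs_domZ fs).
exact: (fs_sum fs _ h).1.
Qed.

Lemma comb_ge0 lam ks : (forall i, 0 <= lam i) -> forall i, 0 <= comb lam ks i.
Proof.
by move=> l0 i; rewrite /comb fct_sumE sumr_ge0// => j _; rewrite fctE mulr_ge0//; exact: w_ge0.
Qed.

Lemma comb_rcons lam ks k : comb lam (rcons ks k) = comb lam ks + lam (size ks) *: w_ k.
Proof.
rewrite /comb size_rcons big_ord_recr/= nth_rcons ltnn eqxx; congr (_ + _).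
by apply: eq_bigr => i _; rewrite nth_rcons ltn_ord.
Qed.

(* The new index must work for all coefficients in the cube at once; by monotonicity
   it is enough to test the points of a fine grid. *)
Lemma l1_block_rcons (d d' : R) ks K : 0 <= d' < d -> l1_block d ks ->
  exists2 k, (K <= k)%N & l1_block d' (rcons ks k).
Proof.
move=> /andP[d'0 dd'] dks; have d0 : 0 < d by exact: le_lt_trans dd'.
(* Of the admissible loss [d - d'], one half pays for [typ_merge] at the grid points and the other
   for rounding to the grid, whose mesh is [1 / D]. *)
set r := size ks; pose eta := (d - d') / 2; have eta0 : 0 < eta by rewrite divr_gt0 ?subr_gt0.
pose D := (Num.truncn (d * r.+1%:R / eta)).+1.
have D0 : 0 < D%:R :> R by rewrite ltr0n.
have Deta : d * r.+1%:R / D%:R <= eta.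
  rewrite ltW// ltr_pdivrMr// (mulrC eta) -ltr_pdivrMr//.
  by have /truncn_itv/andP[] : 0 <= d * r.+1%:R / eta by rewrite ltW// divr_gt0// mulr_gt0.
pose grid (th : {ffun 'I_r.+1 -> 'I_D.+1}) (i : nat) : R := (th (inord i))%:R / D%:R.
have grid0 th i : 0 <= grid th i by rewrite divr_ge0.
have grid1 th i : grid th i <= 1.
  by rewrite ler_pdivrMr// mul1r ler_nat -ltnS.
have /choice[Kth hK] th : exists K, forall k, (K <= k)%N ->
    d * (1 + \sum_(i < r.+1) grid th i) - eta <= typ (comb (grid th) (rcons ks k)).
  set b := grid th r; have b0 : 0 <= b by exact: grid0.
  have b1 : 0 < 1 + b by rewrite ltr_pwDl.
  have [K' hK'] := typ_merge (comb_dom (grid th) ks) (comb_ge0 _ (grid0 th)) b0 eta0.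
  exists K' => k /hK'; rewrite comb_rcons -/r -/b; apply: le_trans; rewrite lerB//.
  have -> : (1 + b)^-1 *: comb (grid th) ks = comb (fun i => (1 + b)^-1 * grid th i) ks.
    by rewrite /comb scaler_sumr; apply: eq_bigr => i _; rewrite scalerA.
  (* Dividing by [1 + b >= 1] stays in the cube, and multiplying the resulting estimate back by
     [1 + b] turns the summand 1 into [1 + b], that is, it counts the new coefficient. *)
  have := dks (fun i => (1 + b)^-1 * grid th i).
  move=> /(_ _)/wrap[i|h].
    rewrite mulr_ge0 ?invr_ge0 ?(ltW b1)//= mulrC ler_pdivrMr// mul1r.
    by rewrite (le_trans (grid1 _ _))// lerDl.
  rewrite -(ler_pM2l b1) in h; apply: le_trans h; rewrite big_ord_recr/= -/b.
  rewrite -mulr_sumr mulrCA ler_pM2l// mulrDr mulr1 mulrA divff ?lt0r_neq0// mul1r.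
  by rewrite -/r; lra.
exists (maxn K (\max_th Kth th)); first exact: leq_maxl.
set k := maxn _ _; move=> lam lam01.
have lam0 i : 0 <= lam i by case/andP: (lam01 i).
pose th : {ffun 'I_r.+1 -> 'I_D.+1} := [ffun i : 'I_r.+1 => inord (Num.truncn (D%:R * lam i))].
have thE i : (i < r.+1)%N -> grid th i = (Num.truncn (D%:R * lam i))%:R / D%:R.
  move=> ir; rewrite /grid ffunE !inordK//.
  rewrite ltnS -(ler_nat R); apply: le_trans (_ : D%:R * lam i <= _).
    by rewrite truncn_le mulr_ge0.
  by rewrite ler_piMr//; case/andP: (lam01 i).
have th_le i : (i < r.+1)%N -> grid th i <= lam i.
  by move=> /thE ->; rewrite ler_pdivrMr// mulrC truncn_le mulr_ge0.
have th_ge i : (i < r.+1)%N -> lam i - D%:R^-1 <= grid th i.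
  move=> /thE ->; rewrite lerBlDr -[X in _ + X]mul1r -mulrDl ler_pdivlMr// mulrC.
  rewrite natr1 ltW//.
  by have /truncn_itv/andP[] : 0 <= D%:R * lam i by rewrite mulr_ge0.
have Kk : (Kth th <= k)%N by rewrite leq_max; apply/orP; right; exact: leq_bigmax.
have := hK th k Kk; rewrite size_rcons -/r => h.
apply: le_trans (le_trans h _); last first.
  apply: typ_mono; [exact: comb_dom|exact: comb_ge0|move=> i].
  rewrite /comb !fct_sumE; apply: ler_sum => j _; rewrite !fctE ler_wpM2r//.
  by apply: th_le; rewrite -[r.+1](size_rcons ks k).
have : \sum_(i < r.+1) lam i - r.+1%:R / D%:R <= \sum_(i < r.+1) grid th i.
  rewrite mulr_natl -[X in _ *+ X]card_ord -sumr_const -sumrB; apply: ler_sum => i _; exact: th_ge.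
move=> /(ler_wpM2l (ltW d0)); rewrite mulrBr mulrA => h'.
have : 0 <= \sum_(i < r.+1) lam i by apply: sumr_ge0.
have e2 : eta * 2 = d - d' by rewrite /eta divfK.
nra.
Qed.

Lemma l1_block_seq (d e : R) : 0 < e -> e < d -> l1_block d [::] ->
  exists kap : nat -> nat, (forall i, (i <= kap i)%N) /\
  forall n, l1_block (d - e) (mkseq kap n).
Proof.
move=> e0 ed d_nil.
(* Strictly decreasing from [d] and always above [d - e], so every extension of the block has some
   loss to spend. *)
pose dr n := d - e + e / n.+1%:R.
have dr_lt n : 0 <= dr n.+1 < dr n.
  rewrite addr_ge0 ?subr_ge0 ?(ltW ed) ?divr_ge0 ?(ltW e0)//=.
  by rewrite ltrD2l ltr_pM2l// ltf_pV2 ?posrE ?ltr0n// ltr_nat.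
pose T := {ks | l1_block (dr (size ks)) ks}.
(* The bound on [k] gives [i <= kap i], hence [kap] tends to infinity; it need not be increasing. *)
pose step (x y : T) := exists2 k, (size (sval x) <= k)%N & sval y = rcons (sval x) k.
have /(@dependent_choice T step) dc : forall x : T, {y | step x y}.
  move=> [ks dks]; apply: cid.
  have [k hk dk] := l1_block_rcons (size ks) (dr_lt (size ks)) dks.
  have {}dk : l1_block (dr (size (rcons ks k))) (rcons ks k) by rewrite size_rcons.
  by exists (exist (fun s => l1_block (dr (size s)) s) _ dk); exists k.
have d0 : l1_block (dr (size (Nil nat))) [::] by rewrite /dr divr1 subrK.
have [f [f0 fS]] := dc (exist (fun s => l1_block (dr (size s)) s) _ d0).
pose kap n := last 0%N (sval (f n.+1)).
have fE n : sval (f n) = mkseq kap n.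
  elim: n => [|n IH]; first by rewrite f0.
  have [k _ fk] := fS n; rewrite mkseqS -IH.
  by rewrite /kap fk last_rcons.
exists kap; split=> n.
  have [k nk fk] := fS n; rewrite /kap fk last_rcons.
  by rewrite fE size_mkseq in nk.
move=> lam lam01; have := proj2_sig (f n); rewrite fE size_mkseq => h.
apply: le_trans (h lam lam01); rewrite size_mkseq ler_wpM2r//.
  by rewrite addr_ge0// sumr_ge0// => i _; case/andP: (lam01 i).
by rewrite lerDl divr_ge0// ltW.
Qed.

(** For a convex combination [v] along [kap] the coefficients sum to 1, so the l_1-estimate reads
    [2 * (typ 0 - e / 2) <= typ v]. As [typ v <= L v + typ 0], it follows that [L v >= typ 0 - e],
    and [ss_mazur] passes this to the limit. *)
Lemma typ_le_lim : typ 0 <= L w.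
Proof.
have E0 := fs_dom0 fs; apply/ler_addgt0Pr => e e0.
have ww : E w by apply: (fs_fatou fs w_cvg (C := C) _).1; exact: nearW.
have [de|ed] := leP (typ 0) (e / 2).
  rewrite (le_trans de)// ler_wpDl ?(fs_ge0 fs)//.
  by rewrite ler_pdivrMr// ler_pMr// ler1n.
have d_nil : l1_block (typ 0) [::].
  by move=> lam _; rewrite /comb /= !big_ord0 addr0 mulr1.
have [kap [kap_ge kapP]] := l1_block_seq (half_gt0 e0) ed d_nil.
rewrite -lerBlDr; apply: (ss_mazur EL (w_ := w_ \o kap) (C := C)).
- by move=> k; exact: w_E.
- move=> i; have kap_oo : kap @ \oo --> \oo.
    by apply/cvgnyPge => A; apply/near_ooP; exists A => k Ak; exact: leq_trans (kap_ge k).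
  exact: (cvg_comp _ _ kap_oo (@w_cvg i)).
(* [l1_block] asks for coefficients in the unit interval at all indices; those beyond [r] are
   unconstrained here and are set to 0. *)
move=> r lam lam0 lam1; pose lam' i := head r lam i.
have lam'01 i : 0 <= lam' i <= 1.
  rewrite /lam' /head; case: ltnP => ir; last by rewrite lexx ler01.
  rewrite lam0/= -lam1 (bigD1 (Ordinal ir))//= lerDl sumr_ge0//.
have := kapP r lam' lam'01; rewrite size_mkseq.
have -> : \sum_(i < r) lam' i = 1.
  by rewrite -[RHS]lam1; apply: eq_bigr => i _; rewrite /lam' /head ltn_ord.
have -> : comb lam' (mkseq kap r) = \sum_(i < r) lam i *: (w_ \o kap) i.
  rewrite /comb size_mkseq; apply: eq_bigr => i _.
  by rewrite /lam' /head ltn_ord nth_mkseq.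
set v := \sum_(i < r) _ => h.
have v0 i : 0 <= v i.
  rewrite /v fct_sumE sumr_ge0// => j _; rewrite fctE mulr_ge0//; exact: w_ge0.
have Ev : E v.
  have hE i : E (lam i *: (w_ \o kap) i) by exact: (fs_domZ fs _ (Ew _)).
  exact: (fs_sum fs r hE).1.
have := typ_le Ev v0.
by lra.
Qed.

End Types.
End Theory.
End SequenceSpaces.

(** * Odell-Schlumprecht norms *)

Section OdellSchlumprecht.
Variable R : realType.
Implicit Types (a b c : nat -> R).
Variables (E : set (nat -> R)) (L : (nat -> R) -> R).
Hypothesis EL : seq_space E L.
Let fs : fatou_seminorm E L := EL.

(** Each natural number decodes to a tail index and a finite rational vector, so that a single index
    runs through all pairs of a tail and a member of a countable dense set. [cvec] takes absolute
    values to stay in the positive cone. *)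
Definition code (j : nat) : nat * seq rat := odflt (0%N, [::]) (unpickle j).
Definition cidx j := (code j).1.
Definition cvec j (i : nat) : R := `|ratr (nth 0 (code j).2 i)|.

Lemma cvec_ge0 j i : 0 <= cvec j i. Proof. exact: normr_ge0. Qed.

Lemma cvec_dom j : E (cvec j).
Proof.
rewrite (_ : cvec j = head (size (code j).2) (cvec j)); first by case: (ss_head EL (size (code j).2) (cvec j)).
apply/funext => i; rewrite /head /cvec; case: ltnP => // h.
by rewrite nth_default// rmorph0 normr0.
Qed.

Lemma cvec_dense c n (e : R) : E c -> (forall i, 0 <= c i) -> 0 < e ->
  exists2 j, cidx j = n & L (cvec j - c) <= e.
Proof.
move=> Ec c0 e0; have e2 := half_gt0 e0.
have /cvgr0Pnorm_le/(_ _ e2)/near_ooP[m hm] := ss_tail EL Ec.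
have m0 : 0 < m.+1%:R :> R by rewrite ltr0n.
have /choice[r hr] : forall i, exists q : rat, ratr q \in `]c i, c i + e / 2 / m.+1%:R[.
  by move=> i; apply: rat_in_itvoo; rewrite ltrDl divr_gt0.
exists (pickle (n, mkseq r m)); rewrite /cidx /cvec /code pickleK//=.
set d := fun i => _.
have Ed : E d by have := cvec_dom (pickle (n, mkseq r m)); rewrite /cvec /code pickleK.
apply: (le_trans (ss_le_head_tail EL m (fs_domB fs Ed Ec))).
rewrite [leRHS]splitr lerD//.
  apply: (@le_trans _ _ (\sum_(i < m) e / 2 / m.+1%:R)).
    apply: ler_sum => i _; rewrite fctE /d nth_mkseq//.
    have := hr i; rewrite in_itv/= => /andP[h1 h2].
    have r0 : 0 <= ratr (r i) :> R by rewrite (le_trans (c0 i))// ltW.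
    by rewrite (ger0_norm r0) ger0_norm ?subr_ge0 ?(ltW h1)// lerBlDl ltW.
  by rewrite sumr_const card_ord -[_ *+ m]mulr_natr mulrAC ler_pdivrMr// ler_pM2l// ler_nat.
apply: le_trans (le_trans (ler_norm _) (hm m (leqnn m))).
apply: (fs_le fs (ss_domtail EL m Ec)) => i; rewrite /tail; case: ltnP => // mi.
by rewrite fctE /d nth_default ?size_mkseq// rmorph0 normr0 sub0r normrN.
Qed.

Definition absv a (i : nat) : R := `|a i|.

(** The factor [L a] makes the expression homogeneous; along a sequence with [L (a_ k)] convergent,
    it turns into a fixed multiple of [cvec j]. *)
Definition os_norm j a := L (L a *: cvec j + tail (cidx j) (absv a)).

Lemma absv_id a : (forall i, 0 <= a i) -> absv a = a.
Proof. by move=> a0; apply/funext => i; rewrite /absv ger0_norm. Qed.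

Section Tails.
Variables (a_ : nat -> nat -> R) (a : nat -> R) (C : R).
Hypothesis a_E : forall k, E (a_ k) /\ L (a_ k) <= C.
Hypothesis a_ge0 : forall k i, 0 <= a_ k i.
Hypothesis a_cvg : forall i, a_ k i @[k --> \oo] --> a i.
Hypothesis L_cauchy : forall e : R, 0 < e ->
  exists K, forall k l, (K <= k)%N -> (K <= l)%N -> `|L (a_ k) - L (a_ l)| <= e.
Hypothesis os_add : forall j (e : R), 0 < e ->
  exists K, forall k l, (K <= k)%N -> (K <= l)%N ->
  `|os_norm j (a_ k) - os_norm j (a_ l)| <= e /\
  os_norm j (a_ k) + os_norm j (a_ l) - e <= os_norm j (a_ k + a_ l).

Let Ea k : E (a_ k). Proof. by case: (a_E k). Qed.

(** The aim is [typ_le_lim] for [w_ k = tail n (a_ k)]. Its hypothesis at a given [c] comes from a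
    norm [os_norm j] with [cvec j] close to [al^-1 *: c], where [al] is the limit of [L (a_ k)]:
    then [L (a_ k) *: cvec j] is close to [c]. If [al = 0], the tails tend to 0 anyway. *)
Lemma os_tails n (e : R) : 0 < e ->
  exists K, forall k, (K <= k)%N -> L (tail n (a_ k)) <= L (tail n a) + e.
Proof.
move=> e0; have /cvg_ex[al al_lim] : cvgn (fun k => L (a_ k)) by exact: cauchy_seq_cvgn.
have /cvgn_distP al_dist := al_lim.
have Ealim : E a by apply: (fs_fatou fs a_cvg (C := C) _).1; exact: nearW.
have al0 : 0 <= al.
  rewrite -(cvg_lim _ al_lim)//; apply: limr_ge; first by apply: cvgP al_lim.
  by apply: nearW => k; exact: (fs_ge0 fs).
have [al_eq0|al_neq0] := eqVneq al 0.
  have [K hK] := al_dist e e0; exists K => k /hK; rewrite al_eq0 subr0 => h.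
  apply: le_trans (ss_tail_le EL n (Ea k)) _; apply: le_trans (le_trans (ler_norm _) h) _.
  by rewrite lerDr (fs_ge0 fs)//; exact: (ss_domtail EL).
have {al_neq0}al_gt0 : 0 < al by rewrite lt_def al_neq0.
pose w_ k := tail n (a_ k).
have w_E k : E (w_ k) /\ L (w_ k) <= C.
  split; first exact: (ss_domtail EL).
  by apply: le_trans (ss_tail_le EL n (Ea k)) _; case: (a_E k).
have w_ge0 k i : 0 <= w_ k i by exact: tail_ge0.
have w_cvg i : w_ k i @[k --> \oo] --> tail n a i.
  by rewrite /w_ /tail; case: ifP => _; [exact: cvg_cst|exact: a_cvg].
have w_add c : E c -> (forall i, 0 <= c i) -> forall e : R, 0 < e ->
    exists K, forall k l, (K <= k)%N -> (K <= l)%N ->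
    `|L (c + w_ k) - L (c + w_ l)| <= e /\
    L (c + w_ k) + L (c + w_ l) - e <= L (2%:R *: c + w_ k + w_ l).
  move=> Ec c0 {e0}e e0.
  (* Two errors of [e / 16] make up [rho], which costs [e / 8]. The additivity estimate spends [rho]
     four times, and [os_add] supplies the other [e / 2]. *)
  have e16 : 0 < e / 16%:R by rewrite divr_gt0// ltr0n.
  have [j jn hj] : exists2 j, cidx j = n & L (cvec j - al^-1 *: c) <= e / 16%:R / al.
    apply: cvec_dense; rewrite ?divr_gt0//; first exact: (fs_domZ fs).
    by move=> i; rewrite fctE mulr_ge0// invr_ge0.
  set d := cvec j in hj; have Ed : E d by exact: cvec_dom.
  have Ld0 : 0 <= L d by exact: (fs_ge0 fs).
  have [K1 h1] := al_dist (e / 16%:R / (L d + 1)) (divr_gt0 e16 (ltr_wpDl Ld0 ltr01)).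
  have [K2 h2] := os_add j (half_gt0 e0).
  have EdcZ r : E (r *: d - c) by apply: (fs_domB fs) => //; exact: (fs_domZ fs).
  have rho k : (K1 <= k)%N -> L (L (a_ k) *: d - c) <= e / 8%:R.
    move=> /h1 hk.
    have -> : L (a_ k) *: d - c = (L (a_ k) - al) *: d + al *: (d - al^-1 *: c).
      apply/funext => i; rewrite !fctE /GRing.scale/=; field; exact: lt0r_neq0.
    have Edal : E (d - al^-1 *: c) by apply: (fs_domB fs) => //; exact: (fs_domZ fs).
    apply: le_trans (fs_triangle fs (fs_domZ fs _ Ed) (fs_domZ fs _ Edal)) _.
    rewrite !(fs_Z fs)// (ger0_norm al0).
    have : al * L (d - al^-1 *: c) <= e / 16%:R by rewrite -ler_pdivlMl// mulrC.
    have : `|L (a_ k) - al| * L d <= e / 16%:R.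
      apply: (@le_trans _ _ (`|L (a_ k) - al| * (L d + 1))); first by rewrite ler_wpM2l// lerDl.
      by rewrite -ler_pdivlMr// ltr_wpDl.
    by lra.
  have os_w k : os_norm j (a_ k) = L (L (a_ k) *: d + w_ k).
    by rewrite /os_norm jn absv_id.
  have Ew k : E (w_ k) by case: (w_E k).
  have Ecw k : E (c + w_ k) by exact: (fs_domD fs).
  have Edw r k : E (r *: d + w_ k) by apply: (fs_domD fs) => //; exact: (fs_domZ fs).
  have close k : (K1 <= k)%N -> `|L (c + w_ k) - os_norm j (a_ k)| <= e / 8%:R.
    move=> /rho hk; rewrite os_w ler_norml; apply/andP; split.
      have := fs_dist fs (Edw (L (a_ k)) k) (Ecw k).
      rewrite (_ : _ + _ - (c + _) = L (a_ k) *: d - c); first by lra.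
      by rewrite opprD addrACA subrr addr0.
    have := fs_dist fs (Ecw k) (Edw (L (a_ k)) k).
    rewrite (_ : c + _ - _ = - (L (a_ k) *: d - c)); last by rewrite opprD addrACA subrr addr0 opprB.
    by rewrite (fs_N fs)//; lra.
  exists (maxn K1 K2) => k l; rewrite !geq_max => /andP[k1 k2] /andP[l1 l2].
  have [h3 h4] := h2 k l k2 l2.
  move: (close k k1) (close l l1) h3; rewrite !ler_norml => /andP[? ?] /andP[? ?] /andP[? ?].
  split; first by apply/andP; split; lra.
  have : os_norm j (a_ k + a_ l) <= L (2%:R *: c + w_ k + w_ l) + e / 8%:R + e / 8%:R.
    have Eu : E (2%:R *: c + w_ k + w_ l).
      by apply: (fs_domD fs) => //; apply: (fs_domD fs) => //; exact: (fs_domZ fs).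
    (* In [os_norm j (a_ k + a_ l)] the scalar [L (a_ k + a_ l)] is at most [L (a_ k) + L (a_ l)];
       since [d] is positive, replacing it only enlarges the norm. *)
    pose v := 2%:R *: c + w_ k + w_ l + (L (a_ k) *: d - c) + (L (a_ l) *: d - c).
    have vE : v = (L (a_ k) + L (a_ l)) *: d + (w_ k + w_ l).
      by apply/funext => i; rewrite /v !fctE /GRing.scale/=; ring.
    have Ev : E v by apply: (fs_domD fs) => //; exact: (fs_domD fs).
    apply: (@le_trans _ _ (L v)).
      apply: (fs_le_mono fs) => // i.
        rewrite fctE addr_ge0//; last by apply: tail_ge0 => ?; exact: normr_ge0.
        by rewrite fctE mulr_ge0 ?cvec_ge0// (fs_ge0 fs)//; exact: (fs_domD fs).
      rewrite vE jn absv_id; last by move=> ?; rewrite fctE addr_ge0.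
      rewrite !fctE lerD//; first by rewrite ler_wpM2r ?cvec_ge0// (fs_triangle fs).
      by rewrite /w_ /tail; case: ifP => _; rewrite ?addr0.
    apply: (le_trans (fs_triangle fs (fs_domD fs Eu (EdcZ _)) (EdcZ _))).
    apply: lerD; last exact: rho.
    apply: (le_trans (fs_triangle fs Eu (EdcZ _))).
    by rewrite lerD2l; exact: rho.
  by lra.
have E0 := fs_dom0 fs.
have t0 : typ L w_ 0 <= L (tail n a) by exact: (typ_le_lim EL w_E w_ge0 w_cvg w_add).
have [K hK] := typ_dist w_add E0 (fun=> lexx 0) e0.
exists K => k /hK; rewrite add0r ler_norml => /andP[_ h].
by rewrite /w_ in h; lra.
Qed.

End Tails.

Lemma os_norm_ge0 j a : E a -> 0 <= os_norm j a.
Proof.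
move=> Ea; apply: (fs_ge0 fs); apply: (fs_domD fs).
  by apply: (fs_domZ fs); exact: cvec_dom.
by apply: (ss_domtail EL); case: (fs_norm fs Ea).
Qed.

Lemma os_dom j r a : E a -> E (r *: cvec j + tail (cidx j) (absv a)).
Proof.
move=> Ea; apply: (fs_domD fs); first by apply: (fs_domZ fs); exact: cvec_dom.
by apply: (ss_domtail EL); case: (fs_norm fs Ea).
Qed.

Lemma os_norm_mono j a b : E a -> (forall i, `|b i| <= `|a i|) -> os_norm j b <= os_norm j a.
Proof.
move=> Ea ba; have Eb := fs_domP fs Ea ba.
apply: (fs_le_mono fs); first exact: os_dom.
  move=> i; rewrite !fctE addr_ge0//; last by apply: tail_ge0 => ?; exact: normr_ge0.
  by rewrite mulr_ge0 ?cvec_ge0 ?(fs_ge0 fs).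
move=> i; rewrite !fctE lerD//; first by rewrite ler_wpM2r ?cvec_ge0 ?(fs_le fs).
by rewrite /tail; case: ifP => // _; exact: ba.
Qed.

Lemma os_norm_triangle j a b : E a -> E b -> os_norm j (a + b) <= os_norm j a + os_norm j b.
Proof.
move=> Ea Eb; have Eab := fs_domD fs Ea Eb.
apply: (le_trans _ (fs_triangle fs (os_dom j (L a) Ea) (os_dom j (L b) Eb))).
apply: (fs_le_mono fs); first by apply: (fs_domD fs); exact: os_dom.
  move=> i; rewrite !fctE addr_ge0//; last by apply: tail_ge0 => ?; exact: normr_ge0.
  by rewrite mulr_ge0 ?cvec_ge0 ?(fs_ge0 fs).
move=> i; rewrite !fctE addrACA lerD//.
  by rewrite -mulrDl ler_wpM2r ?cvec_ge0 ?(fs_triangle fs).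
by rewrite /tail /absv; case: ifP => _; rewrite ?addr0// ler_normD.
Qed.

Lemma os_normZ j r a : E a -> os_norm j (r *: a) = `|r| * os_norm j a.
Proof.
move=> Ea; rewrite {2}/os_norm -(normr_id r) -(fs_Z fs _ (os_dom j (L a) Ea)) /os_norm.
rewrite (fs_Z fs)//; congr L; apply/funext => i; rewrite !fctE /GRing.scale/= mulrDr mulrA.
by congr (_ + _); rewrite /tail /absv; case: ifP => _; rewrite ?mulr0// normrM.
Qed.

Lemma os_norm_le j a : E a -> os_norm j a <= (1 + L (cvec j)) * L a.
Proof.
move=> Ea; have [En Ln] := fs_norm fs Ea.
have Ec := cvec_dom j; have L0 : 0 <= L a by exact: (fs_ge0 fs).
apply: (le_trans (fs_triangle fs (fs_domZ fs (L a) Ec) (ss_domtail EL (cidx j) En))).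
rewrite (fs_Z fs)// (ger0_norm L0) mulrDl mul1r addrC mulrC lerD//.
by rewrite -Ln; exact: (ss_tail_le EL).
Qed.

End OdellSchlumprecht.

(** * Hahn-Banach separation *)

Section HahnBanach.
Variables (R : realType) (V : lmodType R).

Section Extension.
Variable p : V -> R.
Hypothesis p_add : forall x y, p (x + y) <= p x + p y.
Hypothesis p_scale : forall t x, 0 < t -> p (t *: x) = t * p x.

Let p0 : p 0 = 0.
Proof.
have := p_scale 0 (ltr0Sn R 1); rewrite scaler0 => /eqP.
by rewrite -subr_eq0 -[X in X - _]mul1r -mulrBl mulf_eq0 => /orP[|/eqP//]; lra.
Qed.

(** Partial functionals are kept as graphs, so that the union of a chain is an upper bound for
    Zorn's lemma. Single-valuedness is not imposed: it follows from domination, since the fibre over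
    0 is closed under multiples and bounded by [p 0 = 0]. *)
Definition dominated_graph (G : set (V * R)) :=
  (forall a u v, G u -> G v -> G (a *: u.1 + v.1, a * u.2 + v.2)) /\
  (forall u, G u -> u.2 <= p u.1).

Lemma dominated_graph_fun G x s t : dominated_graph G -> G (x, s) -> G (x, t) -> s = t.
Proof.
move=> [Glin Gp] Gs Gt.
have h a : G (x, s) -> G (x, t) -> a * (s - t) <= 0.
  move=> G1 G2; have G0 := Glin (-1) _ _ G1 G1; rewrite /= scaleN1r addNr mulN1r addNr in G0.
  have Gst := Glin (-1) _ _ G2 G1; rewrite /= scaleN1r addNr in Gst.
  have := Gp _ (Glin a _ _ Gst G0); rewrite /= scaler0 !addr0 p0.
  by rewrite mulN1r addrC.
apply/eqP; rewrite -subr_eq0 -sqrf_eq0 eq_le sqr_ge0 andbT expr2.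
exact: h.
Qed.

Lemma dominated_graph_extend G v : dominated_graph G -> G (0, 0) ->
  exists c, dominated_graph
      [set u | exists x s t, G (x, s) /\ u = (x + t *: v, s + t * c)].
Proof.
move=> [Glin Gp] G0.
pose A := [set s - p (x - v) | s in [set: R] & x in [set: V]].
pose B := [set r | exists x s, G (x, s) /\ r = s - p (x - v)].
have AB x s y t : G (x, s) -> G (y, t) -> s - p (x - v) <= p (y + v) - t.
  move=> G1 G2; rewrite lerBrDr addrAC lerBlDr addrC.
  have := Gp _ (Glin 1 _ _ G1 G2); rewrite /= scale1r mul1r => h.
  rewrite addrC (le_trans h)//.
  by rewrite (_ : x + y = (y + v) + (x - v)) ?p_add// addrACA subrr addr0 addrC.
have B0 : B !=set0 by exists (0 - p (0 - v)), 0, 0.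
have Bub : has_ubound B.
  by exists (p (0 + v) - 0) => _ [x [s [G1 ->]]]; exact: AB.
(* Any value between the bounds [s - p (x - v)] and [p (y + v) - t] would do; this is the least. *)
pose c := sup B.
have c1 x s : G (x, s) -> s - p (x - v) <= c by move=> G1; apply: ub_le_sup => //; exists x, s.
have c2 y t : G (y, t) -> c <= p (y + v) - t.
  by move=> G1; apply: ge_sup => // _ [x [s [G2 ->]]]; exact: AB.
have Gscale a x s : G (x, s) -> G (a *: x, a * s).
  by move=> G1; have := Glin a _ _ G1 G0; rewrite /= !addr0.
exists c; split.
  move=> a _ _ [x [s [t [G1 ->]]]] [y [s' [t' [G2 ->]]]] /=.
  exists (a *: x + y), (a * s + s'), (a * t + t'); split; first exact: Glin G1 G2.
  congr pair; last by ring.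
  by rewrite scalerDr scalerDl scalerA addrACA.
move=> _ [x [s [t [G1 ->]]]] /=.
have [t0|t0|->] := ltgtP t 0.
- have nt : 0 < - t by rewrite oppr_gt0.
  have := c1 _ _ (Gscale (- t)^-1 _ _ G1); rewrite -(ler_pM2l nt) mulrBr.
  rewrite mulrA divff ?lt0r_neq0// mul1r -p_scale// scalerBr scalerA divff ?lt0r_neq0//.
  by rewrite scale1r scaleNr opprK; lra.
- have := c2 _ _ (Gscale t^-1 _ _ G1); rewrite -(ler_pM2l t0) mulrBr.
  rewrite -p_scale// scalerDr scalerA mulrA divff ?lt0r_neq0// scale1r mul1r; lra.
by rewrite scale0r mul0r !addr0; exact: Gp G1.
Qed.

Lemma hahn_banach_sublinear : exists f : V -> R^o, linear f /\ forall x, f x <= p x.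
Proof.
have [G [PG Gmax]] : exists G, dominated_graph G /\ forall H, G `<` H -> ~ dominated_graph H.
  apply: Zorn_bigcup => F FP Ftot; split.
    move=> a u v [A FA Au] [B FB Bv].
    have [AB|BA] := Ftot _ _ FA FB.
      by exists B => //; apply: (FP _ FB).1 => //; exact: AB.
    by exists A => //; apply: (FP _ FA).1 => //; exact: BA.
  by move=> u [A FA Au]; exact: (FP _ FA).2.
(* The empty graph is dominated as well. But any element of [G] would yield [(0, 0)] by subtracting
   it from itself, so if [(0, 0)] were missing, [G] would be empty and adjoining that pair would
   enlarge it. *)
have G0 : G (0, 0).
  apply: contrapT => nG0; apply: (Gmax (G `|` [set (0, 0)])).
    by split=> [u|/(_ (0, 0))h]; [left|apply: nG0; apply: h; right].
  have Gnil u : ~ G u.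
    move=> Gu; apply: nG0; have := PG.1 (-1) u u Gu Gu.
    by rewrite scaleN1r addNr mulN1r addNr.
  split=> [a u v [/Gnil//|->] [/Gnil//|->]|u [/Gnil//|->]]; last by rewrite /= p0.
  by right; rewrite /= scaler0 mulr0 !addr0.
have Gtot x : exists s, G (x, s).
  have [c PH] := dominated_graph_extend x PG G0.
  apply: contrapT => nx; apply: Gmax PH; split.
    by move=> [y s] Gys; exists y, s, 0; rewrite scale0r mul0r !addr0.
  move=> /(_ (x, c)) h; apply: nx; exists c; apply: h.
  by exists 0, 0, 1; rewrite scale1r mul1r !add0r.
have [f Gf] := choice Gtot; exists f; split; last by move=> x; exact: PG.2 (Gf x).
move=> a x y; apply: (dominated_graph_fun PG (Gf _)).
exact: PG.1 (Gf x) (Gf y).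
Qed.

End Extension.

(** The infimum [p v] of [q (v + t *: x) - t * d] over [t >= 0] and [x] in [A] is bounded below by
    [- q v] because [d <= q] on [A], and is sublinear because [A] is convex. Taking [t = 0] gives
    [p <= q], and [t = 1] gives [p (- x) <= - d] on [A]; so any linear functional below [p]
    separates. *)
Lemma hahn_banach_separation (q : V -> R) (A : set V) (d : R) :
  (forall x y, q (x + y) <= q x + q y) -> (forall t x, q (t *: x) = `|t| * q x) ->
  A !=set0 -> (forall x y t, A x -> A y -> 0 <= t <= 1 -> A (t *: x + (1 - t) *: y)) ->
  (forall x, A x -> d <= q x) ->
  exists f : V -> R^o, [/\ linear f, forall x, f x <= q x & forall x, A x -> d <= f x].
Proof.
move=> qD qZ [a0 Aa0] Aconv dq.
pose S v := [set r | exists t x, [/\ 0 <= t, A x & r = q (v + t *: x) - t * d]].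
pose p v := inf (S v).
have qN x : q (- x) = q x by rewrite -scaleN1r qZ normrN1 mul1r.
have Slb v r : S v r -> - q v <= r.
  move=> [t [x [t0 Ax ->]]]; have := qD (v + t *: x) (- v).
  rewrite addrAC subrr add0r qN qZ ger0_norm// => h.
  by have := ler_wpM2l t0 (dq _ Ax); lra.
have Shas v : has_lbound (S v) by exists (- q v) => r /Slb.
have Sne v : S v !=set0 by exists (q (v + 0 *: a0) - 0 * d), 0, a0.
have pS v r : S v r -> p v <= r by move=> Sr; exact: ge_inf.
have Sp v c : (forall r, S v r -> c <= r) -> c <= p v.
  by move=> h; apply: lb_le_inf.
have pD x y : p (x + y) <= p x + p y.
  rewrite -lerBlDr; apply: (Sp) => r [t [u [t0 Au ->]]].
  rewrite lerBlDr -lerBlDl; apply: (Sp) => r' [t' [u' [t0' Au' ->]]].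
  rewrite lerBlDl.
  have [w Aw wE] : exists2 w, A w & (t + t') *: w = t *: u + t' *: u'.
    have [tt0|tt0] := eqVneq (t + t') 0.
      exists a0 => //; have [-> ->] : t = 0 /\ t' = 0 by lra.
      by rewrite addr0 !scale0r addr0.
    have tt_gt0 : 0 < t + t' by rewrite lt_def tt0 addr_ge0.
    exists ((t / (t + t')) *: u + (1 - t / (t + t')) *: u').
      by apply: Aconv => //; rewrite divr_ge0 ?addr_ge0//= ler_pdivrMr// mul1r lerDl.
    rewrite scalerDr !scalerA mulrBr mulr1 mulrC divfK//; congr (_ + _ *: _); lra.
  apply: (@le_trans _ _ (q (x + y + (t + t') *: w) - (t + t') * d)).
    by apply: (pS); exists (t + t'), w; rewrite addr_ge0.
  have := qD (x + t *: u) (y + t' *: u').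
  by rewrite wE [X in q X]addrACA; lra.
have pZle t x : 0 < t -> p (t *: x) <= t * p x.
  move=> t0; rewrite -ler_pdivrMl//; apply: (Sp) => r [s [u [s0 Au ->]]].
  rewrite ler_pdivrMl//; apply: (pS); exists (t * s), u; split=> //; first by rewrite mulr_ge0// ltW.
  by rewrite -scalerA -scalerDr qZ gtr0_norm// mulrBr mulrA.
have pZ t x : 0 < t -> p (t *: x) = t * p x.
  move=> t0; apply/eqP; rewrite eq_le pZle//= -ler_pdivlMl//.
  have := pZle t^-1 (t *: x); rewrite scalerA mulVf ?lt0r_neq0// scale1r; apply.
  by rewrite invr_gt0.
have [f [flin fp]] := hahn_banach_sublinear pD pZ.
exists f; split=> // x.
  apply: le_trans (fp x) _; apply: (pS); exists 0, a0; split=> //.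
  by rewrite scale0r addr0 mul0r subr0.
move=> Ax; have fN : f (- x) = - f x.
  have f0 : f 0 = 0.
    by have := flin (-1) 0 0; rewrite scaler0 addr0 scaleN1r addNr.
  by have := flin (-1) x 0; rewrite addr0 scaleN1r f0 addr0 scaleN1r.
rewrite -lerN2 -fN; apply: le_trans (fp _) _; apply: (pS); exists 1, x; split=> //.
rewrite scale1r addNr mul1r; have := qZ 0 0; rewrite scale0r normr0 mul0r => ->.
by rewrite sub0r.
Qed.

End HahnBanach.

(** * The coefficient space of an unconditional basis *)

Lemma lipschitz_cts (R : realType) (V W : normedModType R) (f : V -> W) (C : R) :
  (forall x y, `|f x - f y| <= C * `|x - y|) -> continuous f.
Proof.
move=> fC x; apply/cvgrPdist_le => e e0.
have C0 : 0 < `|C| + 1 by rewrite ltr_wpDl.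
have h : \forall y \near x, `|x - y| <= e / (`|C| + 1).
  by move/cvgrPdist_le: (@cvg_id _ (nbhs x)); apply; rewrite divr_gt0.
apply: filterS h => y; rewrite ler_pdivlMr// => h; apply: le_trans (fC x y) _.
apply: le_trans h; rewrite mulrC ler_wpM2l// (le_trans (ler_norm _))// lerDl.
exact: ler01.
Qed.

Section LinearFunctions.
Variables (R : realType) (V : lmodType R) (f : V -> R^o).
Hypothesis flin : linear f.

Lemma linear_fun0 : f 0 = 0.
Proof. by have := flin (-1) 0 0; rewrite scaler0 addr0 scaleN1r addNr. Qed.

Lemma linear_funZ (r : R) x : f (r *: x) = r * f x.
Proof. by have := flin r x 0; rewrite linear_fun0 !addr0. Qed.

Lemma linear_funB x y : f (x - y) = f x - f y.
Proof. by rewrite -scaleN1r addrC flin scaleN1r addrC. Qed.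

End LinearFunctions.

Section Coefficients.
Variables (R : realType) (X : normedModType R) (e : nat -> X) (K : R).
Hypothesis e1 : forall n, `|e n| = 1.
Hypothesis K1 : 1 <= K.
Hypothesis eK : unconditional_basis_with K setT e.
Implicit Types (a b : nat -> R) (x y : X).

Lemma expansionE a n : expansion a e n = \sum_(i < n) a i *: e i.
Proof. by rewrite /expansion /series /= big_mkord. Qed.

Let coord_ex x : exists a, expansion a e @ \oo --> x.
Proof. by have [[_ /(_ x I)[a [? _]]] _] := eK; exists a. Qed.

Definition coord x : nat -> R := sval (cid (coord_ex x)).

Lemma coord_cvg x : expansion (coord x) e @ \oo --> x.
Proof. exact: svalP (cid (coord_ex x)). Qed.

Lemma coord_uniq a x : expansion a e @ \oo --> x -> coord x = a.
Proof.
have [[_ /(_ x I)[b [_ bu]]] _] := eK.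
by move=> /bu <-; apply/esym/bu; exact: coord_cvg.
Qed.

Lemma coord_linear (r : R) x y : coord (r *: x + y) = r *: coord x + coord y.
Proof.
apply: coord_uniq; have -> : expansion (r *: coord x + coord y) e =
    (fun n => r *: expansion (coord x) e n + expansion (coord y) e n).
  apply/funext => n; rewrite !expansionE scaler_sumr -big_split/=.
  by apply: eq_bigr => i _; rewrite scalerDl scalerA.
apply: cvgD; last exact: coord_cvg.
by apply: cvgZr; exact: coord_cvg.
Qed.

Lemma coord0 : coord 0 = 0.
Proof. by have := coord_linear (-1) 0 0; rewrite !scaleN1r !addNr. Qed.

Lemma coordD x y : coord (x + y) = coord x + coord y.
Proof. by have := coord_linear 1 x y; rewrite !scale1r. Qed.

Lemma coordZ (r : R) x : coord (r *: x) = r *: coord x.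
Proof. by have := coord_linear r x 0; rewrite coord0 !addr0. Qed.

Lemma coordB x y : coord (x - y) = coord x - coord y.
Proof. by rewrite -scaleN1r coordD coordZ scaleN1r. Qed.

Lemma coord_sum (F : nat -> X) r : coord (\sum_(i < r) F i) = \sum_(i < r) coord (F i).
Proof.
by elim: r => [|r IH]; rewrite ?big_ord0 ?coord0// !big_ord_recr/= coordD IH.
Qed.

Lemma sum_ord_widen0 (V : nmodType) (F G : nat -> V) r m : (r <= m)%N ->
  (forall i, (i < r)%N -> G i = F i) -> (forall i, (r <= i)%N -> G i = 0) ->
  \sum_(i < m) G i = \sum_(i < r) F i.
Proof.
move=> rm GF G0; rewrite -(big_mkord xpredT G) (big_cat_nat (leq0n r) rm)/=.
rewrite [X in _ + X]big_nat_cond [X in _ + X]big1 ?addr0; last first.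
  by move=> i /andP[/andP[ri _] _]; rewrite G0.
by rewrite big_mkord; apply: eq_bigr => i _; rewrite GF.
Qed.

Lemma coord_psum a n : coord (\sum_(i < n) a i *: e i) = head n a.
Proof.
apply: coord_uniq; apply: cvg_near_cst.
apply/near_ooP; exists n => k nk; rewrite expansionE.
apply: (@sum_ord_widen0 _ (fun i => a i *: e i) (fun i => head n a i *: e i)) => // i ni.
  by rewrite /head ni.
by rewrite /head ltnNge ni/= scale0r.
Qed.

Lemma coord_flip x (s : nat -> bool) :
  exists2 x', coord x' = (fun n => (-1) ^+ s n * coord x n) & `|x'| <= K * `|x|.
Proof.
have [_ /(_ (coord x) s)] := eK; move=> /= h.
have cx : cvgn (expansion (coord x) e) by apply: cvgP (@coord_cvg x).
have [cx' le] := h cx; exists (limn (expansion (fun n => (-1) ^+ s n * coord x n) e)).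
  exact: coord_uniq.
by apply: le_trans le _; rewrite (cvg_lim _ (@coord_cvg x)).
Qed.

Lemma coord_inj x y : coord x = coord y -> x = y.
Proof.
move=> xy; have := @coord_cvg x; rewrite xy => h.
exact: (cvg_unique _ h (@coord_cvg y)).
Qed.

(** Flipping the signs from index [n] on and averaging with [x] leaves the partial sum, whose norm
    is therefore at most [(1 + K) / 2] times that of [x]. *)
Lemma norm_psum x n : `|\sum_(i < n) coord x i *: e i| <= K * `|x|.
Proof.
have [x' cx' lex'] := coord_flip x (fun i => (n <= i)%N).
set y := \sum_(i < n) _; have : x + x' = 2%:R *: y.
  apply: coord_inj; rewrite coordD coordZ coord_psum cx'; apply/funext => i.
  rewrite !fctE /head /GRing.scale/=; case: leqP => _; rewrite ?expr1 ?expr0; lra.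
move=> /(congr1 Num.norm); rewrite normrZ normr_nat => h.
have := ler_normD x x'; rewrite h; have := normr_ge0 x; move: K1 lex'; nra.
Qed.

Lemma norm_signs a n (s : nat -> bool) :
  `|\sum_(i < n) ((-1) ^+ s i * a i) *: e i| <= K * `|\sum_(i < n) a i *: e i|.
Proof.
have [x' cx' lex'] := coord_flip (\sum_(i < n) a i *: e i) s.
rewrite (_ : \sum_(i < n) ((-1) ^+ s i * a i) *: e i = x')//.
apply: coord_inj; rewrite (coord_psum (fun i => (-1) ^+ s i * a i)) cx' coord_psum; apply/funext => i.
by rewrite /head; case: ifP; rewrite ?mulr0.
Qed.

(* By convexity, one coordinate at a time. *)
Lemma norm_cube (v : X) a (th : nat -> R) n (C : R) : (forall i, `|th i| <= 1) ->
  (forall s : nat -> bool, `|v + \sum_(i < n) ((-1) ^+ s i * a i) *: e i| <= C) ->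
  `|v + \sum_(i < n) (th i * a i) *: e i| <= C.
Proof.
move=> th1; elim: n v => [|n IH] v h.
  by have := h (fun=> true); rewrite !big_ord0.
rewrite big_ord_recr/= [X in v + X]addrC addrA; apply: IH => s.
set S := \sum_(i < n) _.
have h1 (b : bool) : `|v + S + ((-1) ^+ b * a n) *: e n| <= C.
  have := h (fun i => if (i < n)%N then s i else b).
  rewrite big_ord_recr/= ltnn addrA; congr (`|_ + _ + _| <= _).
  by apply: eq_bigr => i _; rewrite ltn_ord.
have := h1 true; have := h1 false; rewrite expr0 expr1 mul1r mulN1r scaleNr => hp hm.
have := th1 n; rewrite ler_norml => /andP[t1 t2].
set A := v + S in hp hm; set B := a n *: e n in hp hm.
have -> : v + (th n * a n) *: e n + S =
   ((1 + th n) / 2) *: (A + B) + ((1 - th n) / 2) *: (A - B).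
  rewrite scalerDr scalerBr addrACA -scalerDl -scalerBl.
  rewrite (_ : (1 + th n) / 2 + (1 - th n) / 2 = 1); last by field.
  rewrite (_ : (1 + th n) / 2 - (1 - th n) / 2 = th n); last by field.
  by rewrite scale1r scalerA addrAC.
have p1 : 0 <= (1 + th n) / 2 by lra.
have p2 : 0 <= (1 - th n) / 2 by lra.
have N1 : `|((1 + th n) / 2) *: (A + B)| <= (1 + th n) / 2 * C.
  by rewrite normrZ ger0_norm// ler_wpM2l.
have N2 : `|((1 - th n) / 2) *: (A - B)| <= (1 - th n) / 2 * C.
  by rewrite normrZ ger0_norm// ler_wpM2l.
apply: (le_trans (ler_normD _ _)); lra.
Qed.

Definition multiplier := {th : nat -> R | forall i, `|th i| <= 1}.

Definition mnorm (p : multiplier * nat) a := `|\sum_(i < p.2) (sval p.1 i * a i) *: e i|.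

Definition Xdom := sup_dom mnorm.
Definition Xnorm a := sup_fam mnorm a.

Lemma mult1_subproof (i : nat) : `|1 : R| <= 1. Proof. by rewrite normr1. Qed.
Definition mult1 : multiplier := exist _ (fun=> 1) mult1_subproof.

Lemma Xnorm_ub (th : nat -> R) n a : (forall i, `|th i| <= 1) -> Xdom a ->
  `|\sum_(i < n) (th i * a i) *: e i| <= Xnorm a.
Proof. by move=> th1; apply: (sup_fam_ub (q := mnorm) (exist _ th th1, n)). Qed.

Lemma Xnorm_le a (C : R) : (forall (th : nat -> R) n, (forall i, `|th i| <= 1) ->
  `|\sum_(i < n) (th i * a i) *: e i| <= C) -> Xdom a /\ Xnorm a <= C.
Proof.
by move=> h; apply: (sup_fam_le (q := mnorm) (mult1, 0%N)) => -[[th th1] n]; exact: h.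
Qed.

Lemma fatou_seminorm_Xnorm : fatou_seminorm Xdom Xnorm.
Proof.
split.
- by apply: (Xnorm_le (C := 0) _).1 => th n _; rewrite big1 ?normr0// => i _; rewrite mulr0 scale0r.
- by move=> a Da; apply: le_trans (Xnorm_ub 0 (svalP mult1) Da); rewrite big_ord0 normr0.
- move=> a b Da ba; apply: Xnorm_le => th n th1.
  (* Where [a i = 0] the quotient is 0 by convention, which is harmless because [b i = 0] there
     too. *)
  pose phi i := b i / a i.
  have phi1 i : `|phi i| <= 1.
    rewrite /phi; have [->|a0] := eqVneq (a i) 0; first by rewrite invr0 mulr0 normr0.
    by rewrite normrM normfV ler_pdivrMr ?normr_gt0// mul1r.
  rewrite (_ : \sum_(i < n) _ = \sum_(i < n) ((th i * phi i) * a i) *: e i).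
    by apply: (Xnorm_ub (th := fun i => th i * phi i)) => // i; rewrite normrM mulr_ile1.
  apply: eq_bigr => i _; congr (_ *: _); rewrite -mulrA; congr (_ * _).
  rewrite /phi; have [a0|a0] := eqVneq (a i) 0; last by rewrite divfK.
  by have := ba i; rewrite a0 normr0 normr_le0 mulr0 => /eqP.
- move=> a b Da Db; apply: Xnorm_le => th n th1.
  rewrite (_ : \sum_(i < n) _ = \sum_(i < n) (th i * a i) *: e i + \sum_(i < n) (th i * b i) *: e i).
    by rewrite (le_trans (ler_normD _ _))// lerD// Xnorm_ub.
  by rewrite -big_split/=; apply: eq_bigr => i _; rewrite -scalerDl -mulrDr.
- move=> c a Da; apply: Xnorm_le => th n th1.
  rewrite (_ : \sum_(i < n) _ = c *: \sum_(i < n) (th i * a i) *: e i).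
    by rewrite normrZ ler_wpM2l// Xnorm_ub.
  by rewrite scaler_sumr; apply: eq_bigr => i _; rewrite scalerA mulrCA.
- move=> s a C sa sC; apply: Xnorm_le => th n th1.
  apply: (@cvgr_to_le _ \oo _ _ (fun k => `|\sum_(i < n) (th i * s k i) *: e i|)); last first.
    by apply: filterS sC => k [Dk]; apply: le_trans; exact: Xnorm_ub.
  apply: cvg_norm; elim: n => [|n IH].
    under eq_fun do rewrite big_ord0; rewrite big_ord0; exact: cvg_cst.
  under eq_fun do rewrite big_ord_recr /=; rewrite big_ord_recr /=.
  apply: cvgD; first exact: IH.
  by apply: cvgZl; apply: cvgM; [exact: cvg_cst|exact: sa].
Qed.

(** One factor [K] pays for the truncation, the other for the signs; general multipliers reduce to
    signs by convexity. *)
Lemma Xnorm_coord x : Xdom (coord x) /\ Xnorm (coord x) <= K ^+ 2 * `|x|.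
Proof.
apply: Xnorm_le => th n th1; rewrite -[X in `|X|]add0r; apply: norm_cube => // s.
rewrite add0r; apply: le_trans (norm_signs _ _ _) _.
by rewrite expr2 -mulrA ler_wpM2l ?norm_psum// (le_trans ler01).
Qed.

Lemma norm_psum_Xnorm a n : Xdom a -> `|\sum_(i < n) a i *: e i| <= Xnorm a.
Proof.
move=> Da; rewrite (_ : \sum_(i < n) _ = \sum_(i < n) (1 * a i) *: e i).
  by apply: (Xnorm_ub (th := fun=> 1)) => // i; rewrite normr1.
by apply: eq_bigr => i _; rewrite mul1r.
Qed.

Lemma norm_le_Xnorm x : `|x| <= Xnorm (coord x).
Proof.
apply: (@cvgr_to_le _ \oo _ _ (fun n => `|expansion (coord x) e n|)).
  by apply: cvg_norm; exact: coord_cvg.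
by apply: nearW => n; rewrite expansionE; apply: norm_psum_Xnorm; case: (Xnorm_coord x).
Qed.

Lemma Xnorm_ge_coord a i : Xdom a -> `|a i| <= Xnorm a.
Proof.
move=> Da; have th1 j : `|(j == i)%:R : R| <= 1.
  by case: eqP => _; rewrite ?normr1 ?normr0.
apply: le_trans (Xnorm_ub i.+1 th1 Da).
rewrite big_ord_recr/= big1 ?add0r ?eqxx ?mul1r ?normrZ ?e1 ?mulr1// => j _.
by rewrite ltn_eqF ?ltn_ord// mul0r scale0r.
Qed.

Lemma Xnorm_unit i : Xdom (unitvec R i) /\ Xnorm (unitvec R i) <= 1.
Proof.
apply: Xnorm_le => th n th1; have [ni|ni] := ltnP i n.
  rewrite (bigD1 (Ordinal ni))//= big1 ?addr0.
    by rewrite /unitvec eqxx mulr1 normrZ e1 mulr1.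
  move=> j ji; rewrite /unitvec; case: eqP => [E|_]; last by rewrite mulr0 scale0r.
  by case/eqP: ji; apply: val_inj.
rewrite big1 ?normr0// => j _; rewrite /unitvec; case: eqP => [E|_]; last by rewrite mulr0 scale0r.
by have := ltn_ord j; rewrite E ltnNge ni.
Qed.

Lemma coord_le x i : `|coord x i| <= K ^+ 2 * `|x|.
Proof. by have [D le] := Xnorm_coord x; apply: le_trans le; exact: Xnorm_ge_coord. Qed.

Lemma coord_dual i : dual (fun x => coord x i : R^o).
Proof.
split=> [r x y|]; first by rewrite coord_linear.
apply: (@lipschitz_cts _ _ _ _ (K ^+ 2)) => x y.
by rewrite (_ : coord x i - coord y i = coord (x - y) i) ?coord_le// coordB.
Qed.

(** * Consequences of reflexivity *)

Section Reflexive.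
Hypothesis X_reflexive : reflexive_space X.

(** The limit of [f (x_ k)] along an ultrafilter finer than [\oo] exists for every [f] in the dual
    and depends on [f] as an element of the bidual, which reflexivity represents by a point.
    Coordinate functionals identify its coefficients. The ultrafilter makes all these limits exist
    at once, with no extraction of subsequences. *)
Lemma weak_limit (x_ : nat -> X) a (C : R) : (forall k, `|x_ k| <= C) ->
  (forall i, coord (x_ k) i @[k --> \oo] --> a i) ->
  exists x, coord x = a /\
  forall (f : X -> R^o) d, dual f -> (forall k, d <= f (x_ k)) -> d <= f x.
Proof.
move=> xC0 xa; have [C' C'0 xC] : exists2 C' : R, 0 < C' & forall k, `|x_ k| <= C'.
  exists (`|C| + 1); first by rewrite ltr_wpDl.
  by move=> k; rewrite (le_trans (xC0 k))// (le_trans (ler_norm _))// lerDl ler01.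
have [U [Uultra ooU]] := @ultraFilterLemma _ \oo _.
have bnd f : dual f -> exists M : R, forall k, `|f (x_ k)| <= M.
  move=> [flin fcont].
  have /cvgrPdist_lt/(_ 1 ltr01) := fcont 0.
  rewrite (linear_fun0 flin) => /nbhs_ballP[del /= del0 h].
  pose t : R := del / 2 / C'; have t0 : 0 < t by rewrite !divr_gt0.
  exists t^-1 => k; rewrite -[leRHS]mulr1 ler_pdivlMl//.
  have := h (t *: x_ k); rewrite -ball_normE/= sub0r normrN normrZ gtr0_norm// => /(_ _)/wrap[|].
    apply: (@le_lt_trans _ _ (t * C')); first by rewrite ler_pM2l.
    have -> : t * C' = del / 2 by rewrite /t divfK// lt0r_neq0.
    by lra.
  by rewrite sub0r normrN (linear_funZ flin) normrM gtr0_norm// => /ltW.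
have fcvg f : dual f -> cvg (f (x_ k) @[k --> U]).
  move=> /bnd[M fM].
  have FM : (f (x_ k) @[k --> U]) `[- M, M]%classic.
    by apply: nearW => k /=; rewrite in_itv/= -ler_norml.
  have [p [_ pcl]] := segment_compact (fmap_proper_filter _ _) FM.
  apply/cvg_ex; exists p => N Np.
  have [//|UN] := in_ultra_setVsetC ((fun k => f (x_ k)) @^-1` N) Uultra.
  by have [y []] := pcl (~` N) N UN Np.
pose Phi (f : X -> R^o) : R := lim (f (x_ k) @[k --> U]).
have Phi_cvg f : dual f -> f (x_ k) @[k --> U] --> Phi f by move=> /fcvg.
have PhiB : bidual Phi.
  split=> [r f g df dg|].
    apply: cvg_lim => //; apply: cvgD; last exact: Phi_cvg.
    by apply: cvgM; [exact: cvg_cst|exact: Phi_cvg].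
  exists C' => f df.
  have op x : `|x| <= 1 -> (`|f x|%:E <= opnorm f)%E.
    by move=> x1; apply: ereal_sup_ubound; exists x.
  case E : (opnorm f) op => [t| |] op.
  - rewrite -EFinM lee_fin.
    apply: (@cvgr_to_le _ U _ _ (fun k => `|f (x_ k)|)); first exact: cvg_norm (Phi_cvg f df).
    apply: nearW => k; have := op (C'^-1 *: x_ k).
    have C'V : 0 < C'^-1 by rewrite invr_gt0.
    rewrite normrZ (linear_funZ df.1) normrM (gtr0_norm C'V) lee_fin !ler_pdivrMl// mulr1; exact.
  - by rewrite gt0_muley ?lte_fin// leey.
  - by have := op 0; rewrite normr0 => /(_ ler01); rewrite leeNy_eq.
have [x xPhi] := X_reflexive PhiB.
exists x; split.
  apply/funext => i; rewrite -[LHS](xPhi _ (coord_dual i)) /Phi.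
  apply: cvg_lim => //; apply: cvg_trans (@xa i); exact: cvg_app.
move=> f d df dfx; rewrite -xPhi//; apply: limr_ge; first exact: fcvg.
exact: nearW.
Qed.

(** Bounded completeness of the basis: a weak limit of the bounded partial sums has the coefficients
    [a]. *)
Lemma Xdom_coord a : Xdom a -> exists x, coord x = a.
Proof.
move=> Da; have [|i|x [xa _]] := @weak_limit (fun n => \sum_(i < n) a i *: e i) a (Xnorm a).
- by move=> n; exact: norm_psum_Xnorm.
- apply: cvg_near_cst; apply/near_ooP; exists i.+1 => k ik.
  by rewrite coord_psum /head ik.
by exists x.
Qed.

(** For the Mazur clause, a functional [f] below the norm and at least [d] on all convex
    combinations of the [x_ k] keeps the bound [d] at the weak limit, so the norm of the limit is at
    least [d]. *)
Lemma seq_space_X : seq_space Xdom Xnorm.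
Proof.
have fs := fatou_seminorm_Xnorm.
split=> //; [exact: Xnorm_ge_coord|exact: Xnorm_unit| |].
  move=> a /Xdom_coord[x <-].
  have xS n : tail n (coord x) = coord (x - expansion (coord x) e n).
    rewrite coordB expansionE coord_psum {2}(head_tail n (coord x)).
    by rewrite addrAC subrr add0r.
  have lim0 : K ^+ 2 * `|x - expansion (coord x) e n| @[n --> \oo] --> 0.
    rewrite -[X in _ --> X](mulr0 (K ^+ 2)); apply: cvgM; first exact: cvg_cst.
    rewrite -(normr0 X) -(subrr x); apply: cvg_norm; apply: cvgB; first exact: cvg_cst.
    exact: coord_cvg.
  apply: (squeeze_cvgr _ (cvg_cst 0) lim0); apply: nearW => n.
  by rewrite xS; have [D ->] := Xnorm_coord (x - expansion (coord x) e n); rewrite andbT (fs_ge0 fs).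
move=> w_ w C d wC ww wd.
have /choice[x_ xw] k : exists x, coord x = w_ k by apply: Xdom_coord; case: (wC k).
have Dc x : Xdom (coord x) by case: (Xnorm_coord x).
pose q x := Xnorm (coord x).
pose A := [set x | exists r (lam : nat -> R), [/\ forall i, 0 <= lam i,
  \sum_(i < r) lam i = 1 & x = \sum_(i < r) lam i *: x_ i]].
have qD x y : q (x + y) <= q x + q y by rewrite /q coordD (fs_triangle fs).
have qZ t x : q (t *: x) = `|t| * q x by rewrite /q coordZ (fs_Z fs).
have Ax k : A (x_ k).
  exists k.+1, (fun i => (i == k)%:R); split=> [i|//|]; first by rewrite ler0n.
    rewrite big_ord_recr/= big1 ?add0r ?eqxx// => i _.
    by rewrite ltn_eqF.
  rewrite big_ord_recr/= big1 ?add0r ?eqxx ?scale1r// => i _.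
  by rewrite ltn_eqF ?scale0r.
have widen (lam : nat -> R) r m : (r <= m)%N ->
    \sum_(i < m) head r lam i = \sum_(i < r) lam i.
  move=> rm; apply: sum_ord_widen0 => // i ri; first by rewrite /head ri.
  by rewrite /head ltnNge ri.
have widenZ (lam : nat -> R) r m : (r <= m)%N ->
    \sum_(i < m) head r lam i *: x_ i = \sum_(i < r) lam i *: x_ i.
  move=> rm; apply: (@sum_ord_widen0 _ (fun i => lam i *: x_ i) (fun i => head r lam i *: x_ i)) => // i ri.
    by rewrite /head ri.
  by rewrite /head ltnNge ri/= scale0r.
have Aconv x y t : A x -> A y -> 0 <= t <= 1 -> A (t *: x + (1 - t) *: y).
  move=> [r [l [l0 l1 ->]]] [r' [l' [l'0 l'1 ->]]] /andP[t0 t1].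
  exists (maxn r r'), (fun i => t * head r l i + (1 - t) * head r' l' i); split.
  - move=> i; rewrite addr_ge0// mulr_ge0 ?subr_ge0//; rewrite /head; case: ifP => _ //.
  - rewrite big_split/= -!mulr_sumr (widen l _ _ (leq_maxl r r')) (widen l' _ _ (leq_maxr r r')).
    by rewrite l1 l'1 !mulr1 addrC subrK.
  - rewrite -(widenZ l _ _ (leq_maxl r r')) -(widenZ l' _ _ (leq_maxr r r')).
    rewrite !scaler_sumr -big_split/=; apply: eq_bigr => i _.
    by rewrite !scalerA -scalerDl.
have dq x : A x -> d <= q x.
  move=> [r [l [l0 l1 ->]]]; rewrite /q (coord_sum (fun i => l i *: x_ i)).
  under eq_bigr do rewrite coordZ xw.
  exact: wd.
have [f [flin fq fd]] := hahn_banach_separation qD qZ (ex_intro _ _ (Ax 0%N)) Aconv dq.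
have fle x : f x <= K ^+ 2 * `|x| by apply: le_trans (fq x) _; case: (Xnorm_coord x).
have fdual : dual f.
  split=> //; apply: (@lipschitz_cts _ _ _ _ (K ^+ 2)) => x y.
  rewrite -(linear_funB flin) ler_norml fle andbT -[f _]opprK lerN2.
  by rewrite -sub0r -(linear_fun0 flin) -(linear_funB flin) sub0r opprB distrC; exact: fle.
have [k|i|x [xw' hx]] := @weak_limit x_ w C.
- by apply: le_trans (norm_le_Xnorm _) _; rewrite xw; case: (wC k).
- by under eq_fun do rewrite xw; exact: ww.
by rewrite -xw'; apply: le_trans (hx f d fdual _) (fq x) => k; exact: fd (Ax k).
Qed.

End Reflexive.
End Coefficients.

(** * Banach spaces of sequences *)

Section BanachSequenceSpaces.
Variable R : realType.

Record banach_seq := BanachSeq {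
  bs_dom : set (nat -> R);
  bs_norm : (nat -> R) -> R;
  bs_dom0 : bs_dom 0;
  bs_dom_lin : forall r a b, bs_dom a -> bs_dom b -> bs_dom (r *: a + b);
  bs_triangle : forall a b, bs_dom a -> bs_dom b -> bs_norm (a + b) <= bs_norm a + bs_norm b;
  bs_normZ : forall r a, bs_dom a -> bs_norm (r *: a) = `|r| * bs_norm a;
  bs_norm_eq0 : forall a, bs_dom a -> bs_norm a = 0 -> a = 0;
  bs_complete : forall s : nat -> nat -> R, (forall k, bs_dom (s k)) ->
    (forall e : R, 0 < e -> exists K, forall k l, (K <= k)%N -> (K <= l)%N ->
       bs_norm (s k - s l) <= e) ->
    exists2 a, bs_dom a & bs_norm (s k - a) @[k --> \oo] --> 0 }.

Variable B : banach_seq.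

Definition bs_pred : {pred nat -> R} := fun a => `[< bs_dom B a >].

Lemma bs_predP a : reflect (bs_dom B a) (a \in bs_pred).
Proof. exact: asboolP. Qed.

Lemma bs_submod_closed : submod_closed bs_pred.
Proof.
split; first by apply/bs_predP; exact: bs_dom0.
by move=> r a b /bs_predP Da /bs_predP Db; apply/bs_predP; exact: bs_dom_lin.
Qed.

HB.instance Definition _ := GRing.isSubmodClosed.Build R (nat -> R) bs_pred bs_submod_closed.

Record bs_type := BsType { bs_val : nat -> R ; _ : bs_val \in bs_pred }.

HB.instance Definition _ := [isSub for bs_val].
HB.instance Definition _ := [Choice of bs_type by <:].
HB.instance Definition _ := [SubChoice_isSubLmodule of bs_type by <:].

Lemma bs_valP (x : bs_type) : bs_dom B (bs_val x).
Proof. by apply/bs_predP; case: x. Qed.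

Definition bs_mk a (Da : bs_dom B a) : bs_type := BsType (introT (bs_predP a) Da).

Lemma bs_val_inj : injective bs_val. Proof. exact: val_inj. Qed.

Lemma bs_valD x y : bs_val (x + y) = bs_val x + bs_val y. Proof. by []. Qed.
Lemma bs_valB x y : bs_val (x - y) = bs_val x - bs_val y. Proof. by []. Qed.
Lemma bs_val0 : bs_val 0 = 0. Proof. by []. Qed.
Lemma bs_valZ (r : R) x : bs_val (r *: x) = r *: bs_val x. Proof. by []. Qed.

Let nm (x : bs_type) := bs_norm B (bs_val x).

Let nmD x y : nm (x + y) <= nm x + nm y.
Proof. by rewrite /nm bs_valD bs_triangle//; exact: bs_valP. Qed.

Let nmZ (r : R) x : nm (r *: x) = `|r| * nm x.
Proof. by rewrite /nm bs_valZ bs_normZ//; exact: bs_valP. Qed.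

Let nm0 x : nm x = 0 -> x = 0.
Proof.
by move=> h; apply: bs_val_inj; rewrite bs_val0; exact: bs_norm_eq0 (bs_valP x) h.
Qed.

HB.instance Definition _ := Lmodule_isNormed.Build R bs_type nmD nmZ nm0.

Lemma bs_normE (x : bs_type) : `|x| = bs_norm B (bs_val x). Proof. by []. Qed.

(** Centres of balls of radius [1 / (n + 1)] belonging to [F] form a Cauchy sequence, and [F]
    converges to its limit. *)
Lemma bs_cauchy_cvg (F : set_system bs_type) : ProperFilter F -> cauchy F -> cvg F.
Proof.
move=> FF /cauchyP Fc.
have hn n : exists x, F (ball x (n.+1%:R^-1 : R)) by apply: Fc; rewrite invr_gt0.
have [u Fu] := choice hn.
have udist k l : `|u k - u l| <= k.+1%:R^-1 + l.+1%:R^-1.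
  have [z [/= uz1 uz2]] := filter_ex (filterI (Fu k) (Fu l)).
  rewrite -ball_normE /= in uz1; rewrite -ball_normE /= in uz2.
  rewrite -(subrKA z) (le_trans (ler_normD _ _))// lerD ?(ltW uz1)//.
  by rewrite distrC ltW.
have small (e : R) : 0 < e -> exists K, forall k, (K <= k)%N -> k.+1%:R^-1 <= e.
  move=> e0; exists (Num.truncn e^-1) => k Kk.
  rewrite invf_ple ?posrE// ltW//; have /truncn_itv/andP[_] : 0 <= e^-1 by rewrite invr_ge0 ltW.
  by move=> h; apply: lt_le_trans h _; rewrite ler_nat.
have [e e0|a Da ua] := bs_complete (fun k => @bs_valP (u k)).
  have [K hK] := small _ (half_gt0 e0); exists K => k l Kk Kl.
  rewrite -bs_valB -bs_normE (le_trans (udist k l))// [leRHS]splitr; apply: lerD; exact: hK.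
apply: (@cvgP _ F (bs_mk Da)); apply/cvgrPdist_le => e e0.
have [K1 hK1] := small _ (half_gt0 e0).
have /cvgr0Pnorm_le/(_ _ (half_gt0 e0))/near_ooP[K2 hK2] := ua.
pose k := maxn K1 K2; apply: filterS (Fu k) => z.
rewrite -ball_normE /= => /ltW kz.
rewrite -(subrKA (u k)) (le_trans (ler_normD _ _))// [leRHS]splitr lerD//.
  have := hK2 k (leq_maxr _ _); rewrite distrC bs_normE bs_valB; apply: le_trans.
  exact: ler_norm.
by rewrite (le_trans kz)//; apply: hK1; exact: leq_maxl.
Qed.

HB.instance Definition _ := Uniform_isComplete.Build bs_type bs_cauchy_cvg.

End BanachSequenceSpaces.

(** * The symmetric space *)

Section SymmetricHull.
Variable R : realType.
Variables (E : set (nat -> R)) (L : (nat -> R) -> R).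
Hypothesis EL : seq_space E L.
Let fs : fatou_seminorm E L := EL.
Let fs2 := @fatou_seminorm_l2 R.
Implicit Types (x y z a : nat -> R).

Definition hlf : R := 2^-1.
Definition csc n : R := hlf ^+ (n * n).
Definition bsize n : nat := (4 ^ (n * n + n))%N.
Definition bsc n : R := (bsize n)%:R.
(** The height of the normalised block vector, forced by [csc n * bsc n * lam n = 1]. *)
Definition lam n : R := hlf ^+ (n * n + n + n).

Lemma hlf_gt0 : 0 < hlf. Proof. by rewrite invr_gt0. Qed.
Lemma hlf_le1 : hlf <= 1. Proof. by rewrite invf_le1// ler1n. Qed.
Lemma hlfX_gt0 k : 0 < hlf ^+ k. Proof. by rewrite exprn_gt0// hlf_gt0. Qed.

Lemma hlfX_le m n : (m <= n)%N -> hlf ^+ n <= hlf ^+ m.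
Proof. by move=> mn; rewrite ler_wiXn2l// ?hlf_le1// ltW// hlf_gt0. Qed.

Lemma bsc_ge0 n : 0 <= bsc n. Proof. exact: ler0n. Qed.
Lemma bsize_gt0 n : (0 < bsize n)%N. Proof. by rewrite expn_gt0. Qed.

Lemma bsc_hlf n k : bsc n * hlf ^+ (n * n + n + (n * n + n) + k) = hlf ^+ k.
Proof.
rewrite exprD mulrA /bsc /bsize natrX; set m := (n * n + n)%N.
rewrite addnn -mul2n exprM -exprMn (_ : 4%:R * hlf ^+ 2 = 1) ?expr1n ?mul1r//.
by rewrite /hlf; field.
Qed.

Lemma csc_lam n : csc n * bsc n * lam n = 1.
Proof.
rewrite mulrAC /csc /lam -exprD mulrC -[RHS](expr0 hlf) -(bsc_hlf n 0).
by congr (_ * _ ^+ _); lia.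
Qed.

Lemma csc_gt0 n : 0 < csc n. Proof. exact: hlfX_gt0. Qed.

Definition kav y n := csc n * kfun (bsc n) y.

Lemma kav_ge0 y n : l2dom y -> 0 <= kav y n.
Proof.
move=> Dy; rewrite mulr_ge0 ?(ltW (csc_gt0 n))//.
exact: (fs_ge0 (fatou_seminorm_kfun (bsc_ge0 n)) (kdom_l2 (bsc_ge0 n) Dy)).
Qed.

Lemma kav_mono y z n : l2dom y -> (forall i, `|z i| <= `|y i|) -> kav z n <= kav y n.
Proof.
move=> Dy zy; rewrite ler_wpM2l ?(ltW (csc_gt0 n))//.
exact: (fs_le (fatou_seminorm_kfun (bsc_ge0 n)) (kdom_l2 (bsc_ge0 n) Dy)).
Qed.

Lemma kav_triangle y z n : l2dom y -> l2dom z -> kav (y + z) n <= kav y n + kav z n.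
Proof.
move=> Dy Dz; rewrite -mulrDr ler_wpM2l ?(ltW (csc_gt0 n))//.
exact: (fs_triangle (fatou_seminorm_kfun (bsc_ge0 n)) (kdom_l2 _ Dy) (kdom_l2 _ Dz)).
Qed.

Lemma kavZ c y : l2dom y -> kav (c *: y) = `|c| *: kav y.
Proof.
move=> Dy; apply/funext => n; rewrite /kav.
rewrite (fs_Z (fatou_seminorm_kfun (bsc_ge0 n)) _ (kdom_l2 (bsc_ge0 n) Dy)).
by rewrite mulrCA.
Qed.

Lemma kav_dist y z n : l2dom y -> l2dom z -> `|kav y n - kav z n| <= kav (y - z) n.
Proof.
move=> Dy Dz; have h u v : l2dom u -> l2dom v -> kav u n - kav v n <= kav (u - v) n.
  move=> Du Dv; rewrite lerBlDr -{1}(subrK v u); apply: kav_triangle => //.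
  exact: (fs_domB fs2).
rewrite ler_norml h// andbT lerNl opprB (le_trans (h _ _ Dz Dy))//.
by apply: kav_mono => [|i]; [exact: (fs_domB fs2)|rewrite !fctE distrC].
Qed.

(** The constant is [2 ^+ (n * n + n + n)], unbounded in [n]: l_2-convergence controls [kav] on
    heads only. *)
Lemma kav_le_l2 y n : l2dom y -> kav y n <= csc n * bsc n * l2 y.
Proof.
move=> Dy; rewrite /kav -mulrA ler_wpM2l ?(ltW (csc_gt0 n))//.
exact: (kfun_l2 (bsc_ge0 n) Dy).
Qed.

Definition Ydom y := l2dom y /\ E (kav y).

(** By [os_norm_le], these weights make the Odell-Schlumprecht terms sum to at most
    [2 * L (kav y)]. *)
Definition osw j : R := hlf ^+ j / (1 + L (cvec R j)).

Definition Mser y (j : nat) : R :=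
  match j with
  | 0 => l2 y
  | 1 => L (kav y)
  | j.+2 => osw j * os_norm L j (kav y)
  end.

(* The l_2-sum makes every [Mser y j] pass to the limit in the 2R condition. *)
Definition Ynorm y := l2 (Mser y).

Lemma osw_gt0 j : 0 < osw j.
Proof.
rewrite divr_gt0 ?hlfX_gt0// ltr_wpDr// (fs_ge0 fs)//; exact: (cvec_dom EL).
Qed.

Lemma Mser_ge0 y j : Ydom y -> 0 <= Mser y j.
Proof.
move=> [Dy Ey]; case: j => [|[|j]] /=; first exact: (fs_ge0 fs2).
  exact: (fs_ge0 fs).
by rewrite mulr_ge0 ?(ltW (osw_gt0 j)) ?(os_norm_ge0 EL).
Qed.

Lemma Ydom_dominated y z : Ydom y -> l2dom z -> (forall n, kav z n <= kav y n) -> Ydom z.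
Proof.
move=> [Dy Ey] Dz zy; split=> //; apply: (fs_domP fs Ey) => n.
by rewrite !ger0_norm ?kav_ge0.
Qed.

Lemma Mser_mono y z j : Ydom y -> l2dom z -> l2 z <= l2 y ->
  (forall n, kav z n <= kav y n) -> Mser z j <= Mser y j.
Proof.
move=> [Dy Ey] Dz lzy zy; case: j => [|[|j]] //=.
  by apply: (fs_le_mono fs) => // i; exact: kav_ge0.
rewrite ler_wpM2l ?(ltW (osw_gt0 j))//; apply: (os_norm_mono EL) => // n.
by rewrite !ger0_norm ?kav_ge0.
Qed.

Lemma Ydom_ideal y z : Ydom y -> (forall i, `|z i| <= `|y i|) -> Ydom z.
Proof.
move=> Yy zy; have [Dy _] := Yy; have Dz := fs_domP fs2 Dy zy.
by apply: Ydom_dominated Yy Dz _ => n; exact: kav_mono.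
Qed.

Lemma Ydom0 : Ydom 0.
Proof.
have D0 := fs_dom0 fs2; split=> //.
have -> : kav 0 = 0 by have h := kavZ 0 D0; rewrite normr0 !scale0r in h; exact: h.
exact: fs_dom0 fs.
Qed.

Lemma YdomD y z : Ydom y -> Ydom z -> Ydom (y + z).
Proof.
move=> [Dy Ey] [Dz Ez]; have Dyz : l2dom (y + z) by exact: (fs_domD fs2).
split=> //; apply: (fs_domP fs (fs_domD fs Ey Ez)) => n.
rewrite !ger0_norm ?kav_ge0//; first exact: kav_triangle.
by rewrite fctE addr_ge0 ?kav_ge0.
Qed.

Lemma YdomZ c y : Ydom y -> Ydom (c *: y).
Proof.
move=> [Dy Ey]; split; first exact: (fs_domZ fs2).
by rewrite kavZ//; exact: (fs_domZ fs).
Qed.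

Lemma YdomB y z : Ydom y -> Ydom z -> Ydom (y - z).
Proof. by move=> Yy Yz; apply: YdomD => //; rewrite -scaleN1r; exact: YdomZ. Qed.

Lemma Mser_triangle y z j : Ydom y -> Ydom z -> Mser (y + z) j <= Mser y j + Mser z j.
Proof.
move=> Yy Yz; have [Dyz Eyz] := YdomD Yy Yz; have [Dy Ey] := Yy; have [Dz Ez] := Yz.
have EE := fs_domD fs Ey Ez.
case: j => [|[|j]] /=; first exact: (fs_triangle fs2).
  apply: (le_trans _ (fs_triangle fs Ey Ez)); apply: (fs_le_mono fs) => // i; first exact: kav_ge0.
  exact: kav_triangle.
rewrite -mulrDr ler_wpM2l ?(ltW (osw_gt0 j))//.
apply: (le_trans _ (os_norm_triangle EL j Ey Ez)); apply: (os_norm_mono EL) => // i.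
by rewrite !ger0_norm ?kav_ge0 ?kav_triangle// fctE addr_ge0 ?kav_ge0.
Qed.

Lemma MserZ c y : Ydom y -> Mser (c *: y) = `|c| *: Mser y.
Proof.
move=> [Dy Ey]; apply/funext => -[|[|j]]; rewrite fctE /GRing.scale/= ?(fs_Z fs2)//.
  by rewrite kavZ// (fs_Z fs)// normr_id.
by rewrite kavZ// (os_normZ EL)// normr_id mulrCA.
Qed.

Lemma sum_hlf n : \sum_(i < n) hlf ^+ i <= 2.
Proof.
have -> : \sum_(i < n) hlf ^+ i = 2 - 2 * hlf ^+ n.
  elim: n => [|n IH]; first by rewrite big_ord0 expr0 mulr1 subrr.
  by rewrite big_ord_recr/= IH exprS /hlf; field.
by rewrite lerBlDr lerDl mulr_ge0// ltW// hlfX_gt0.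
Qed.

(** The l_2-norm is bounded by the l_1-norm; 3 is 1 for the term [L (kav y)] and 2 for the weighted
    ones. *)
Lemma Mser_l2 y : Ydom y -> l2dom (Mser y) /\ Ynorm y <= l2 y + 3 * L (kav y).
Proof.
move=> Yy; have [Dy Ey] := Yy; have l0 : 0 <= l2 y by exact: (fs_ge0 fs2).
have L0 : 0 <= L (kav y) by exact: (fs_ge0 fs).
apply: l2_le => n; apply: le_trans (l2trunc_le_sum _ _) _.
apply: (@le_trans _ _ (\sum_(i < n.+2) `|Mser y i|)).
  by apply: (ler_sum_nat_widen (F := fun i => `|Mser y i|)) => //; rewrite -addn2 leq_addr.
have -> : 3 * L (kav y) = L (kav y) + 2 * L (kav y) by ring.
rewrite !big_ord_recl /= !ger0_norm// !lerD2l.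
apply: (@le_trans _ _ (\sum_(i < n) hlf ^+ i * L (kav y))); last by rewrite -mulr_suml ler_wpM2r ?sum_hlf.
apply: ler_sum => i _; rewrite ger0_norm ?(Mser_ge0 i.+2 Yy)//=.
have c0 : 0 < 1 + L (cvec R i) by rewrite ltr_wpDr// (fs_ge0 fs)//; exact: (cvec_dom EL).
rewrite /osw -mulrA ler_pM2l ?hlfX_gt0// mulrC ler_pdivrMr// mulrC.
exact: (os_norm_le EL).
Qed.

Lemma Mser_le_Ynorm y j : Ydom y -> Mser y j <= Ynorm y.
Proof.
by move=> Yy; rewrite -[leLHS]ger0_norm ?Mser_ge0//; apply: l2_coord; case: (Mser_l2 Yy).
Qed.

Lemma l2_le_Ynorm y : Ydom y -> l2 y <= Ynorm y.
Proof. exact: (@Mser_le_Ynorm y 0). Qed.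

Lemma L_le_Ynorm y : Ydom y -> L (kav y) <= Ynorm y.
Proof. exact: (@Mser_le_Ynorm y 1). Qed.

(** Permutations and block averages are seen to be contractions of [Y] through this: it suffices
    that they do not increase [l2] and the K-functionals. *)
Lemma Ynorm_mono y z : Ydom y -> l2dom z -> l2 z <= l2 y ->
  (forall n, kav z n <= kav y n) -> Ynorm z <= Ynorm y.
Proof.
move=> Yy Dz lzy zy; have Yz := Ydom_dominated Yy Dz zy.
apply: (fs_le fs2); first by case: (Mser_l2 Yy).
by move=> j; rewrite !ger0_norm ?Mser_ge0// Mser_mono.
Qed.

Lemma Ynorm_ideal y z : Ydom y -> (forall i, `|z i| <= `|y i|) -> Ynorm z <= Ynorm y.
Proof.
move=> Yy zy; have [Dy _] := Yy; have [Dz lzy] := fs_ideal fs2 Dy zy.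
by apply: Ynorm_mono => // n; exact: kav_mono.
Qed.

Lemma Ynorm_triangle y z : Ydom y -> Ydom z -> Ynorm (y + z) <= Ynorm y + Ynorm z.
Proof.
move=> Yy Yz; have Yyz := YdomD Yy Yz.
have [Dy _] := Mser_l2 Yy; have [Dz _] := Mser_l2 Yz.
apply: (le_trans _ (fs_triangle fs2 Dy Dz)).
apply: (fs_le_mono fs2); first exact: (fs_domD fs2).
  by move=> i; exact: Mser_ge0.
by move=> i; exact: Mser_triangle.
Qed.

Lemma YnormZ c y : Ydom y -> Ynorm (c *: y) = `|c| * Ynorm y.
Proof.
move=> Yy; rewrite /Ynorm MserZ// (fs_Z fs2) ?normr_id//; by case: (Mser_l2 Yy).
Qed.

Lemma Ynorm_ge0 y : Ydom y -> 0 <= Ynorm y.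
Proof. by move=> Yy; apply: (fs_ge0 fs2); case: (Mser_l2 Yy). Qed.

Lemma Ynorm_coord y i : Ydom y -> `|y i| <= Ynorm y.
Proof. by move=> Yy; apply: le_trans (l2_le_Ynorm Yy); case: Yy => Dy _; exact: l2_coord. Qed.

Lemma Ynorm_eq0 y : Ydom y -> Ynorm y = 0 -> y = 0.
Proof.
move=> Yy y0; apply/funext => i; apply/eqP; rewrite -normr_le0 -y0.
exact: Ynorm_coord.
Qed.

Lemma kav_cvg (s : nat -> nat -> R) y n : (forall k, l2dom (s k)) -> l2dom y ->
  l2 (s k - y) @[k --> \oo] --> 0 -> kav (s k) n @[k --> \oo] --> kav y n.
Proof.
move=> Ds Dy h; apply/cvgrPdist_le => e e0.
have C0 : 0 < csc n * bsc n by rewrite mulr_gt0 ?csc_gt0// ltr0n bsize_gt0.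
have /cvgr0Pnorm_le/(_ (e / (csc n * bsc n)) (divr_gt0 e0 C0)) := h.
apply: filterS => k hk; rewrite distrC; apply: le_trans (kav_dist _ (Ds k) Dy) _.
have Dsy : l2dom (s k - y) by exact: (fs_domB fs2).
apply: (le_trans (kav_le_l2 n Dsy)); rewrite -ler_pdivlMl// mulrC.
exact: le_trans (ler_norm _) hk.
Qed.

Lemma Ynorm_complete (s : nat -> nat -> R) : (forall k, Ydom (s k)) ->
  (forall e : R, 0 < e -> exists K, forall k l, (K <= k)%N -> (K <= l)%N ->
     Ynorm (s k - s l) <= e) ->
  exists2 a, Ydom a & Ynorm (s k - a) @[k --> \oo] --> 0.
Proof.
move=> Ys sc; have Ds k : l2dom (s k) by case: (Ys k).
pose y i := limn (fun k => s k i).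
have sy i : s k i @[k --> \oo] --> y i.
  apply: cauchy_seq_cvgn => e /sc[K hK]; exists K => k l Kk Kl.
  exact: le_trans (Ynorm_coord i (YdomB (Ys k) (Ys l))) (hK k l Kk Kl).
have diff (e : R) : 0 < e -> exists K, forall k, (K <= k)%N ->
    l2dom (s k - y) /\ l2 (s k - y) <= e.
  move=> /sc[K hK]; exists K => k Kk; apply: (fs_fatou fs2 (s := fun l => s k - s l)).
    by move=> i; apply: cvgB; [exact: cvg_cst|exact: sy].
  apply/near_ooP; exists K => l Kl; have Ykl := YdomB (Ys k) (Ys l).
  by split; [case: Ykl|exact: le_trans (l2_le_Ynorm Ykl) (hK k l Kk Kl)].
have Dy : l2dom y.
  have [K /(_ K (leqnn _))[h _]] := diff 1 ltr01.
  by rewrite -(subKr (s K) y); exact: (fs_domB fs2).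
(* Coordinatewise convergence would not make [kav (s k - s l)] converge as [l] grows;
   l_2-convergence does, and then the Fatou property of [L] applies. *)
have l2cvg k : l2 (s k - s l - (s k - y)) @[l --> \oo] --> 0.
  apply/cvgr0Pnorm_le => e /diff[K hK]; apply/near_ooP; exists K => l /hK[h1 h2].
  rewrite opprB addrC addrA subrK -opprB.
  by rewrite (fs_N fs2)// ger0_norm// (fs_ge0 fs2).
have diffY (e : R) : 0 < e -> exists K, forall k, (K <= k)%N ->
    Ydom (s k - y) /\ L (kav (s k - y)) <= e.
  move=> /sc[K hK]; exists K => k Kk.
  have Dky : l2dom (s k - y) by exact: (fs_domB fs2).
  have [|/=|Ek Lk] := fs_fatou fs (s := fun l => kav (s k - s l)) (a := kav (s k - y)) (C := e).
  - by move=> i; apply: kav_cvg => // l; exact: (fs_domB fs2).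
  - apply/near_ooP; exists K => l Kl; have Ykl := YdomB (Ys k) (Ys l).
    by split; [case: Ykl|exact: le_trans (L_le_Ynorm Ykl) (hK k l Kk Kl)].
  - by split.
exists y.
  have [K /(_ K (leqnn _))[h _]] := diffY 1 ltr01.
  by rewrite -(subKr (s K) y); exact: YdomB.
apply/cvgr0Pnorm_le => e e0; have e4 : 0 < e / 4%:R by rewrite divr_gt0// ltr0n.
have [K1 h1] := diff _ e4; have [K2 h2] := diffY _ e4.
apply/near_ooP; exists (maxn K1 K2) => k; rewrite geq_max => /andP[/h1[_ h3] /h2[Yk h4]].
rewrite ger0_norm ?Ynorm_ge0//; have [_] := Mser_l2 Yk; lra.
Qed.

Lemma Ydom_lin r y z : Ydom y -> Ydom z -> Ydom (r *: y + z).
Proof. by move=> Yy Yz; apply: YdomD => //; exact: YdomZ. Qed.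

Definition Yspace : banach_seq R :=
  BanachSeq Ydom0 Ydom_lin Ynorm_triangle YnormZ Ynorm_eq0 Ynorm_complete.

(** The square of [2 - e / 4] is at least [4 - e]. For [e >= 8] that base may be negative, but then
    [4 - e] is too. *)
Lemma near_two_defect (p q r e : R) : 0 <= p -> p <= 1 -> 0 <= q -> q <= 1 -> 0 <= r ->
  2 - e / 4%:R <= r -> 2 * p ^+ 2 + 2 * q ^+ 2 - r ^+ 2 <= e.
Proof.
move=> p0 p1 q0 q1 r0 re.
have p2 : p ^+ 2 <= 1 by rewrite expr_le1.
have q2 : q ^+ 2 <= 1 by rewrite expr_le1.
suff : 4%:R - e <= r ^+ 2 by lra.
have [e8|e8] := leP 8%:R e; first by have := sqr_ge0 r; lra.
have e2 : 0 <= 2 - e / 4%:R by lra.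
have : (2 - e / 4%:R) ^+ 2 <= r ^+ 2 by rewrite lerXn2r ?nnegrE.
by have := sqr_ge0 e; rewrite !expr2; lra.
Qed.

(** * The 2R property *)

Section TwoRotund.
Variable s : nat -> nat -> R.
Hypothesis Ys : forall k, Ydom (s k) /\ Ynorm (s k) <= 1.
Hypothesis s2 : forall e : R, 0 < e -> exists K, forall k l, (K <= k)%N -> (K <= l)%N ->
  2 - e <= Ynorm (s k + s l).

Let Y k : Ydom (s k). Proof. by case: (Ys k). Qed.
Let D k : l2dom (s k). Proof. by case: (Y k). Qed.

Lemma Mser_defect j (e : R) : 0 < e -> exists K, forall k l, (K <= k)%N -> (K <= l)%N ->
  2 * Mser (s k) j ^+ 2 + 2 * Mser (s l) j ^+ 2 - Mser (s k + s l) j ^+ 2 <= e.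
Proof.
move=> e0; have e4 : 0 < e / 4%:R by rewrite divr_gt0// ltr0n.
have [K hK] := s2 e4; exists K => k l Kk Kl; have := hK k l Kk Kl.
have Ykl := YdomD (Y k) (Y l).
have [Dk _] := Mser_l2 (Y k); have [Dl _] := Mser_l2 (Y l); have [Dkl _] := Mser_l2 Ykl.
have := @l2_defect R _ _ _ j Dk Dl Dkl; rewrite -/(Ynorm _) -/(Ynorm _) -/(Ynorm _).
move=> /(_ _)/wrap[i|h1 h2]; first by rewrite Mser_ge0//= Mser_triangle.
apply: le_trans h1 _; have [_ nk] := Ys k; have [_ nl] := Ys l.
exact: (near_two_defect (Ynorm_ge0 (Y k)) nk (Ynorm_ge0 (Y l)) nl (Ynorm_ge0 Ykl) h2).
Qed.

(** For [0 <= r <= p + q] the defect is the sum of [(p - q) ^+ 2] and [(p + q) ^+ 2 - r ^+ 2], and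
    the latter is at least [(p + q - r) ^+ 2]. *)
Lemma Mser_cauchy j (e : R) : 0 < e -> exists K, forall k l, (K <= k)%N -> (K <= l)%N ->
  `|Mser (s k) j - Mser (s l) j| <= e /\
  Mser (s k) j + Mser (s l) j - e <= Mser (s k + s l) j.
Proof.
move=> e0; have [K hK] := Mser_defect j (mulr_gt0 e0 e0).
exists K => k l Kk Kl; have := hK k l Kk Kl.
have := Mser_ge0 j (Y k); have := Mser_ge0 j (Y l); have := Mser_ge0 j (YdomD (Y k) (Y l)).
have := Mser_triangle j (Y k) (Y l).
move: (Mser (s k + s l) j) (Mser (s k) j) (Mser (s l) j) => r p q rpq r0 q0 p0 h; split.
  rewrite -(@ler_pXn2r _ 2%N)// ?nnegrE ?(ltW e0)// real_normK ?num_real//.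
  have : r ^+ 2 <= (p + q) ^+ 2 by rewrite lerXn2r ?nnegrE ?addr_ge0.
  by rewrite expr2 in h *; nra.
rewrite lerBlDr -lerBlDl -(@ler_pXn2r _ 2%N)// ?nnegrE ?(ltW e0)// ?subr_ge0//.
by have := sqr_ge0 (p - q); rewrite !expr2 in h *; nra.
Qed.

Lemma l2_cauchy (e : R) : 0 < e -> exists K, forall k l, (K <= k)%N -> (K <= l)%N ->
  l2 (s k - s l) <= e.
Proof.
move=> e0; have [K hK] := Mser_defect 0 (mulr_gt0 e0 e0).
exists K => k l Kk Kl; have := hK k l Kk Kl => /=.
have Dkl : l2dom (s k - s l) by exact: (fs_domB fs2).
have := l2_parallelogram (D k) (D l) => h1 h2.
rewrite -(@ler_pXn2r _ 2%N)// ?nnegrE ?(ltW e0)// ?(fs_ge0 fs2)//.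
by rewrite [leRHS]expr2; lra.
Qed.

Lemma Ynorm_cauchy (e : R) : 0 < e -> exists K, forall k l, (K <= k)%N -> (K <= l)%N ->
  Ynorm (s k - s l) <= e.
Proof.
have Dkl k l : l2dom (s k - s l) by exact: (fs_domB fs2).
have Ekav k : E (kav (s k)) by case: (Y k).
have kav_lim i : kav (s k) i @[k --> \oo] --> limn (fun k => kav (s k) i).
  apply: cauchy_seq_cvgn => e0 e00.
  have C0 : 0 < csc i * bsc i by rewrite mulr_gt0 ?csc_gt0// ltr0n bsize_gt0.
  have [K hK] := l2_cauchy (divr_gt0 e00 C0); exists K => k l Kk Kl.
  apply: le_trans (kav_dist i (D k) (D l)) _; apply: le_trans (kav_le_l2 i (Dkl k l)) _.
  by rewrite -ler_pdivlMl// mulrC hK.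
pose a i := limn (fun k => kav (s k) i).
have aE k : E (kav (s k)) /\ L (kav (s k)) <= 1.
  by split=> //; apply: le_trans (L_le_Ynorm (Y k)) _; case: (Ys k).
have a_ge0 k i : 0 <= kav (s k) i by exact: kav_ge0.
have Lc (e0 : R) : 0 < e0 -> exists K, forall k l, (K <= k)%N -> (K <= l)%N ->
    `|L (kav (s k)) - L (kav (s l))| <= e0.
  by move=> /(Mser_cauchy 1)[K hK]; exists K => k l Kk Kl; case: (hK k l Kk Kl).
have osc j (e0 : R) : 0 < e0 -> exists K, forall k l, (K <= k)%N -> (K <= l)%N ->
    `|os_norm L j (kav (s k)) - os_norm L j (kav (s l))| <= e0 /\
    os_norm L j (kav (s k)) + os_norm L j (kav (s l)) - e0
      <= os_norm L j (kav (s k) + kav (s l)).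
  move=> e00; have g0 := osw_gt0 j.
  have [K hK] := Mser_cauchy j.+2 (mulr_gt0 g0 e00); exists K => k l Kk Kl.
  have [/= h1 h2] := hK k l Kk Kl; split.
    by move: h1; rewrite -mulrBr normrM gtr0_norm// ler_pM2l.
  rewrite -mulrDr -mulrBr ler_pM2l// in h2; apply: le_trans h2 _.
  apply: (os_norm_mono EL); first exact: (fs_domD fs).
  move=> i; have Dp : l2dom (s k + s l) by exact: (fs_domD fs2).
  by rewrite !ger0_norm ?kav_ge0 ?kav_triangle// fctE addr_ge0 ?kav_ge0.
have tails := os_tails EL aE a_ge0 kav_lim Lc osc.
have aEE : E a by apply: (fs_fatou fs kav_lim (C := 1) _).1; exact: nearW.
(* The two tails cost [2 * e / 18] each and the head with the l_2-term at most [e / 18]; the factor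
   3 of [Mser_l2] keeps the total below [e]. *)
move=> e0; have e18 : 0 < e / 18%:R by rewrite divr_gt0// ltr0n.
have /cvgr0Pnorm_le/(_ _ e18)/near_ooP[n /(_ n (leqnn n)) hn] := ss_tail EL aEE.
have [K1 h1] := tails n _ e18.
pose S := \sum_(i < n) csc i * bsc i.
have S0 : 0 <= S by apply: sumr_ge0 => i _; rewrite mulr_ge0 ?bsc_ge0// ltW// csc_gt0.
have S1 : 0 < S + 1 by rewrite ltr_wpDl.
have [K2 h2] := l2_cauchy (divr_gt0 e18 S1).
exists (maxn K1 K2) => k l; rewrite !geq_max => /andP[k1 k2] /andP[l1 l2'].
have Ykl := YdomB (Y k) (Y l); have [_ /le_trans] := Mser_l2 Ykl; apply.
have l2kl := h2 k l k2 l2'; have l20 := fs_ge0 fs2 (Dkl k l).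
rewrite ler_pdivlMr// mulrDr mulr1 in l2kl.
have [_ Ekl] := Ykl; have := ss_le_head_tail EL n Ekl.
have : \sum_(i < n) `|kav (s k - s l) i| <= S * l2 (s k - s l).
  rewrite mulr_suml; apply: ler_sum => i _; rewrite ger0_norm ?kav_ge0//; exact: kav_le_l2.
have : L (tail n (kav (s k - s l))) <= L (tail n (kav (s k))) + L (tail n (kav (s l))).
  apply: le_trans (fs_triangle fs (ss_domtail EL n (Ekav k)) (ss_domtail EL n (Ekav l))).
  apply: (fs_le_mono fs); first by apply: (fs_domD fs); exact: (ss_domtail EL).
    by apply: tail_ge0 => i; exact: kav_ge0.
  move=> i; rewrite [leRHS](_ : _ = tail n (kav (s k)) i + tail n (kav (s l)) i)//.
  rewrite /tail; case: ifP => _; first by rewrite addr0.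
  rewrite (le_trans (kav_triangle _ (D k) (fs_domN fs2 (D l))))// lerD2l.
  by apply: kav_mono => // j; rewrite fctE normrN.
have := h1 k k1; have := h1 l l1; have := le_trans (ler_norm _) hn.
have : 0 <= S * l2 (s k - s l) by rewrite mulr_ge0.
by rewrite mulrC in l2kl *; lra.
Qed.

End TwoRotund.
End SymmetricHull.

(** * Embedding into the symmetric space *)

Section Embedding.
Variable R : realType.
Variables (E : set (nat -> R)) (L : (nat -> R) -> R).
Hypothesis EL : seq_space E L.
Let fs : fatou_seminorm E L := EL.
Let fs2 := @fatou_seminorm_l2 R.
Implicit Types (x y z a al : nat -> R).

Definition blk := block bsize_gt0.
Definition blkstart := start bsize.

Lemma blk_start m : blk (blkstart m) = m.
Proof. exact: block_start. Qed.

Lemma lam_gt0 m : 0 < lam R m. Proof. exact: hlfX_gt0. Qed.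

Definition embed al (i : nat) : R := lam R (blk i) * al (blk i).
Definition unembed y (m : nat) : R := y (blkstart m) / lam R m.

Lemma embedK al : unembed (embed al) = al.
Proof.
by apply/funext => m; rewrite /unembed /embed blk_start mulrC mulKf// lt0r_neq0// lam_gt0.
Qed.

Lemma unembedK y : (forall i, y i = y (blkstart (blk i))) -> embed (unembed y) = y.
Proof.
move=> yc; apply/funext => i; rewrite /embed /unembed mulrC divfK -?yc//.
by rewrite lt0r_neq0// lam_gt0.
Qed.

Lemma embed_linear (r : R) a b : embed (r *: a + b) = r *: embed a + embed b.
Proof. by apply/funext => i; rewrite /embed !fctE /GRing.scale/=; ring. Qed.

Lemma embedB a b : embed (a - b) = embed a - embed b.
Proof. by rewrite -scaleN1r addrC embed_linear scaleN1r addrC. Qed.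

Lemma unembedB x y : unembed (x - y) = unembed x - unembed y.
Proof. by apply/funext => i; rewrite /unembed !fctE; ring. Qed.

Lemma embed_head k al :
  embed (head k al) = \sum_(m < k) (lam R m * al m) *: blockvec R bsize_gt0 m.
Proof.
apply/funext => i; rewrite fct_sumE /embed /head; case: ltnP => ik.
  rewrite (bigD1 (Ordinal ik))//= big1 ?addr0.
    by rewrite fctE /blockvec eqxx /GRing.scale/= mulr1.
  move=> j ji; rewrite fctE /blockvec; case: eqP => [E'|]; last by rewrite /GRing.scale/= mulr0.
  by case/eqP: ji; apply: val_inj.
rewrite mulr0 big1// => j _; rewrite fctE /blockvec.
case: eqP => [E'|]; last by rewrite /GRing.scale/= mulr0.
by move: (ltn_ord j); rewrite -E' ltnNge ik.
Qed.

Lemma embed_head_cvg al i : embed (head k al) i @[k --> \oo] --> embed al i.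
Proof.
apply: cvg_near_cst; apply/near_ooP; exists (blk i).+1 => k ik.
by rewrite /embed /head ik.
Qed.

Lemma lam_l2_block m : lam R m * l2 (blockvec R bsize_gt0 m) <= hlf R ^+ m.
Proof.
have [_ h] := @l2_blockvec R _ bsize_gt0 m.
apply: (le_trans (ler_wpM2l (ltW (lam_gt0 m)) h)).
have -> : (bsize m)%:R = (2 ^+ (m * m + m)) ^+ 2 :> R.
  by rewrite /bsize natrX -exprM mulnC exprM (_ : 4%:R = 2 ^+ 2)// expr2; ring.
rewrite sqrtr_sqr ger0_norm ?exprn_ge0//.
rewrite /lam exprD mulrAC -exprMn (_ : hlf R * 2 = 1) ?expr1n ?mul1r//.
by rewrite /hlf mulVf.
Qed.

Lemma kav_block_eq n : csc R n * (lam R n * kfun (bsc R n) (blockvec R bsize_gt0 n)) <= 1.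
Proof.
rewrite -(csc_lam R n) mulrA mulrAC ler_wpM2r ?(ltW (lam_gt0 n))//.
by rewrite ler_wpM2l ?(ltW (csc_gt0 _ n))// kfun_blockvec// bsc_ge0.
Qed.

(** For [n < m] the mass bound leaves the ratio of [lam m] to [lam n]; for [m < n] the size bound
    leaves that of [csc n] to [csc m]. Both exponents are differences of quadratics at distinct
    integers, hence at least [n + m]. *)
Lemma kav_block_neq n m : n != m ->
  csc R n * (lam R m * kfun (bsc R n) (blockvec R bsize_gt0 m)) <= hlf R ^+ (n + m).
Proof.
rewrite neq_ltn => /orP[nm|mn].
  apply: (@le_trans _ _ (csc R n * bsc R n * lam R m)).
    rewrite mulrA mulrAC ler_wpM2r ?(ltW (lam_gt0 m))//.
    by rewrite ler_wpM2l ?(ltW (csc_gt0 _ n))// kfun_blockvec// bsc_ge0.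
  have -> : lam R m = lam R n * hlf R ^+ (m * m + m + m - (n * n + n + n)).
    by rewrite /lam -exprD; congr (_ ^+ _); nia.
  by rewrite mulrA csc_lam mul1r; apply: hlfX_le; nia.
apply: (@le_trans _ _ (csc R n * (bsc R m * lam R m))).
  rewrite ler_wpM2l ?(ltW (csc_gt0 _ n))// mulrC ler_wpM2r ?(ltW (lam_gt0 m))//.
  by rewrite kfun_blockvec_size// bsc_ge0.
have -> : csc R n = csc R m * hlf R ^+ (n * n - m * m).
  by rewrite /csc -exprD; congr (_ ^+ _); nia.
by rewrite mulrAC mulrA csc_lam mul1r; apply: hlfX_le; nia.
Qed.

Lemma geometric_dom : E (fun n => hlf R ^+ n) /\ L (fun n => hlf R ^+ n) <= 2.
Proof.
apply: (fs_fatou fs (s := fun k => head k (fun n => hlf R ^+ n))).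
  move=> i; apply: cvg_near_cst; apply/near_ooP; exists i.+1 => k ik.
  by rewrite /head ik.
apply: nearW => k; have [Eh Lh] := ss_head EL k (fun n => hlf R ^+ n); split=> //.
apply: le_trans Lh (le_trans _ (sum_hlf R k)); apply: ler_sum => i _.
by rewrite ger0_norm// ltW// hlfX_gt0.
Qed.

(** The diagonal of the block interaction gives [|al n|] and the rest at most [2 * L al * hlf ^+ n],
    so [L (kav (embed al))] is at most [5 * L al]. With [l2 (embed al) <= 2 * L al] the constant is
    [2 + 3 * 5]. *)
Lemma embed_bound al : E al -> Ydom E (embed al) /\ Ynorm L (embed al) <= 17%:R * L al.
Proof.
move=> Ea; have La0 : 0 <= L al by exact: (fs_ge0 fs).
have [l2d l2b] : l2dom (embed al) /\ l2 (embed al) <= 2 * L al.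
  apply: (fs_fatou fs2 (s := fun k => embed (head k al))); first by move=> i; exact: embed_head_cvg.
  apply: nearW => k; rewrite embed_head.
  have Db m : l2dom ((lam R m * al m) *: blockvec R bsize_gt0 m).
    by apply: (fs_domZ fs2); case: (@l2_blockvec R _ bsize_gt0 m).
  have [h1 h2] := fs_sum fs2 k Db; split=> //; apply: le_trans h2 _.
  apply: (@le_trans _ _ (\sum_(i < k) hlf R ^+ i * L al)); last first.
    by rewrite -mulr_suml ler_wpM2r// sum_hlf.
  apply: ler_sum => i _; have [Di _] := @l2_blockvec R _ bsize_gt0 i.
  rewrite (fs_Z fs2)// normrM (gtr0_norm (lam_gt0 i)) mulrAC.
  by rewrite ler_pM ?mulr_ge0 ?(ltW (lam_gt0 i)) ?(fs_ge0 fs2) ?lam_l2_block ?(ss_coord EL).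
have kb n : kav (embed al) n <= `|al n| + 2 * L al * hlf R ^+ n.
  have fsk := fatou_seminorm_kfun (bsc_ge0 R n).
  have c0 := csc_gt0 R n; rewrite /kav -ler_pdivlMl//.
  apply: (fs_fatou fsk (s := fun k => embed (head k al)) _ _).2; first by move=> i; exact: embed_head_cvg.
  apply: nearW => k; rewrite embed_head.
  have Dbv m : kdom (bsc R n) (blockvec R bsize_gt0 m).
    by apply: (kdom_l2 (bsc_ge0 R n)); case: (@l2_blockvec R _ bsize_gt0 m).
  have Db m : kdom (bsc R n) ((lam R m * al m) *: blockvec R bsize_gt0 m).
    exact: (fs_domZ fsk).
  have [h1 h2] := fs_sum fsk k Db; split=> //; apply: le_trans h2 _.
  rewrite ler_pdivlMl// mulr_sumr.
  have term m : csc R n * kfun (bsc R n) ((lam R m * al m) *: blockvec R bsize_gt0 m) <=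
      (if m == n then `|al n| else 0) + hlf R ^+ m * (L al * hlf R ^+ n).
    rewrite (fs_Z fsk)// normrM (gtr0_norm (lam_gt0 m)).
    rewrite (mulrAC (lam R m)) [leLHS]mulrA.
    case: eqVneq => [->|mn].
      rewrite -[leLHS]addr0 lerD//=; first by rewrite ler_piMl// kav_block_eq.
      by rewrite !mulr_ge0// ltW// hlfX_gt0.
    rewrite add0r (_ : hlf R ^+ m * _ = hlf R ^+ (n + m) * L al); last by rewrite exprD; ring.
    rewrite ler_pM// ?(ss_coord EL)//; last by rewrite kav_block_neq// eq_sym.
    rewrite !mulr_ge0 ?(ltW c0) ?(ltW (lam_gt0 m))//; exact: (fs_ge0 fsk).
  apply: (le_trans (ler_sum _ (fun (i : 'I_k) _ => term i))).
  rewrite big_split/= lerD//.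
    rewrite -big_mkcond/=; case: (ltnP n k) => nk.
      by rewrite (big_pred1 (Ordinal nk))// => i; rewrite -val_eqE.
    rewrite big1// => i /eqP E'; by have := ltn_ord i; rewrite E' ltnNge nk.
  by rewrite -mulr_suml -mulrA ler_wpM2r ?sum_hlf// mulr_ge0// ltW// hlfX_gt0.
have [Eg Lg] := geometric_dom; have [En Ln] := fs_norm fs Ea.
pose bd := (fun i => `|al i|) + (2 * L al) *: (fun n => hlf R ^+ n).
have Ebd : E bd by apply: (fs_domD fs) => //; exact: (fs_domZ fs).
have Lbd : L bd <= 5%:R * L al.
  apply: (le_trans (fs_triangle fs En (fs_domZ fs (2 * L al) Eg))).
  by rewrite (fs_Z fs)// Ln ger0_norm ?mulr_ge0//; nra.
have Ek : E (kav (embed al)).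
  apply: (fs_domP fs Ebd) => i; rewrite ger0_norm ?kav_ge0//; apply: le_trans (ler_norm _).
  exact: kb.
have Lk : L (kav (embed al)) <= L bd.
  by apply: (fs_le_mono fs Ebd) => i; [exact: kav_ge0|exact: kb].
split=> //; have [_] := Mser_l2 EL (conj l2d Ek); move: Lk Lbd l2b; lra.
Qed.

Lemma unembed_bound y : Ydom E y -> (forall i, y i = y (blkstart (blk i))) ->
  E (unembed y) /\ L (unembed y) <= Ynorm L y.
Proof.
move=> Yy yc; have [Dy Ey] := Yy.
have h m : `|unembed y m| <= `|kav y m|.
  rewrite (ger0_norm (kav_ge0 _ Dy)) /unembed normrM normfV (gtr0_norm (lam_gt0 m)).
  rewrite ler_pdivrMr ?lam_gt0// -[leLHS]mul1r -(csc_lam R m) mulrAC ler_wpM2r ?(ltW (lam_gt0 m))//.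
  rewrite -mulrA ler_wpM2l ?(ltW (csc_gt0 _ m))//.
  apply: (@kfun_block_ge R _ bsize_gt0 y m); first exact: (kdom_l2 (bsc_ge0 R m) Dy).
  by move=> i im; rewrite yc /blk im.
have [Eu Lu] := fs_ideal fs Ey h; split=> //; apply: le_trans Lu _.
exact: (L_le_Ynorm EL).
Qed.

Lemma Ydom_unitvec i : Ydom E (unitvec R i).
Proof.
have [Eu _] := ss_unit EL (blk i); have [Yu _] := embed_bound Eu.
apply: (Ydom_ideal EL (YdomZ EL (lam R (blk i))^-1 Yu)) => j.
rewrite fctE /embed /unitvec; case: eqP => [->|_]; last by rewrite normr0.
by rewrite eqxx mulr1 /GRing.scale/= mulVf// lt0r_neq0// lam_gt0.
Qed.

Lemma l2_tail_cvg y : l2dom y -> l2 (tail n y) @[n --> \oo] --> 0.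
Proof.
move=> Dy; have Dt n : l2dom (tail n y) by apply: (fs_domP fs2 Dy) => i; exact: norm_tail_le.
apply/cvgr0Pnorm_le => e e0.
have [m hm] : exists m, l2 y ^+ 2 - e ^+ 2 <= l2trunc m y ^+ 2.
  apply: contrapT => nh; have : l2 y ^+ 2 <= l2 y ^+ 2 - e ^+ 2.
    apply: sqr_l2_le => // m; rewrite leNgt; apply/negP => /ltW h.
    by apply: nh; exists m.
  by have := exprn_gt0 2 e0; lra.
apply/near_ooP; exists m => n mn; rewrite ger0_norm ?(fs_ge0 fs2)//.
rewrite -(@ler_pXn2r _ 2%N)// ?nnegrE ?(ltW e0)// ?(fs_ge0 fs2)//.
apply: sqr_l2_le => // k.
have h : l2trunc k (tail n y) ^+ 2 + l2trunc m y ^+ 2 <= l2 y ^+ 2.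
  apply: le_trans (sqr_l2trunc_le (maxn k m) Dy).
  have h1 := sqr_l2trunc_mono (tail n y) (leq_maxl k m).
  have h2 := sqr_l2trunc_mono (head m y) (leq_maxr k m).
  apply: (@le_trans _ _ (l2trunc (maxn k m) (tail n y) ^+ 2 + l2trunc (maxn k m) (head m y) ^+ 2)).
    apply: lerD => //; apply: le_trans h2; rewrite !sqr_l2trunc le_eqVlt; apply/orP; left.
    by apply/eqP/eq_bigr => i _; rewrite /head ltn_ord.
  rewrite !sqr_l2trunc -big_split/=; apply: ler_sum => i _; rewrite /tail /head.
  case: (ltnP i n) => ni; case: (ltnP i m) => mi; rewrite ?expr0n/= ?add0r ?addr0 ?sqr_ge0//.
  by have := leq_trans mi mn; rewrite ltnNge ni.
by lra.
Qed.

(** [kav (tail n y)] is dominated by [kav y] and tends to 0 coordinatewise, since [l2 (tail n y)]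
    does; order continuity of [L] concludes. *)
Lemma Ynorm_tail_cvg y : Ydom E y -> Ynorm L (tail n y) @[n --> \oo] --> 0.
Proof.
move=> Yy; have [Dy Ey] := Yy.
have Yt n : Ydom E (tail n y) by apply: (Ydom_ideal EL Yy) => i; exact: norm_tail_le.
have h1 := l2_tail_cvg Dy.
have h2 : L (kav (tail n y)) @[n --> \oo] --> 0.
  apply: (ss_dominated_cvg0 EL Ey) => [k i|i].
    rewrite !ger0_norm ?kav_ge0//; last by case: (Yt k).
    by apply: kav_mono => // j; exact: norm_tail_le.
  have h3 : csc R i * bsc R i * l2 (tail n y) @[n --> \oo] --> 0.
    by rewrite -[X in _ --> X](mulr0 (csc R i * bsc R i)); apply: cvgM => //; exact: cvg_cst.
  apply: (squeeze_cvgr _ (cvg_cst 0) h3); apply: nearW => n.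
  by have [Dt _] := Yt n; rewrite kav_ge0// kav_le_l2.
have h3 : l2 (tail n y) + 3 * L (kav (tail n y)) @[n --> \oo] --> 0.
  rewrite -[X in _ --> X](addr0 0) -[X in _ --> _ + X](mulr0 3); apply: cvgD => //.
  by apply: cvgM => //; exact: cvg_cst.
apply: (squeeze_cvgr _ (cvg_cst 0) h3); apply: nearW => n.
by rewrite (Ynorm_ge0 EL)//=; case: (Mser_l2 EL (Yt n)).
Qed.

Lemma Ydom_perm (sg tau : nat -> nat) y : cancel sg tau -> cancel tau sg -> Ydom E y ->
  Ydom E (y \o sg) /\ Ynorm L (y \o sg) <= Ynorm L y.
Proof.
move=> sgK tauK Yy; have [Dy _] := Yy; have [Dp lp] := l2_perm sgK tauK Dy.
have kp n : kav (y \o sg) n <= kav y n.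
  rewrite ler_wpM2l ?(ltW (csc_gt0 _ n))//.
  by have [] := kfun_perm sgK tauK (bsc_ge0 R n) (kdom_l2 (bsc_ge0 R n) Dy).
split; first exact: (Ydom_dominated EL Yy).
exact: (Ynorm_mono EL).
Qed.

Definition Yavg y := avg bsize_gt0 y.

Lemma Ydom_avg y : Ydom E y -> Ydom E (Yavg y) /\ Ynorm L (Yavg y) <= Ynorm L y.
Proof.
move=> Yy; have [Dy _] := Yy; have [Dp lp] := l2_avg bsize_gt0 Dy.
have kp n : kav (Yavg y) n <= kav y n.
  rewrite ler_wpM2l ?(ltW (csc_gt0 _ n))//.
  by have [] := kfun_avg bsize_gt0 (bsc_ge0 R n) (kdom_l2 (bsc_ge0 R n) Dy).
split; first exact: (Ydom_dominated EL Yy).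
exact: (Ynorm_mono EL).
Qed.

Lemma Yavg_linear (r : R) x y : Yavg (r *: x + y) = r *: Yavg x + Yavg y.
Proof.
apply/funext => i; rewrite /Yavg /avg /blocksum.
rewrite (eq_bigr (fun j => r * x j + y j))// big_split/= -mulr_sumr mulrDl -mulrA.
by [].
Qed.

Lemma Yavg_block y i : Yavg y i = Yavg y (blkstart (blk i)).
Proof. exact: avg_start. Qed.

Lemma Yavg_const y : (forall i, y i = y (blkstart (blk i))) -> Yavg y = y.
Proof. exact: avg_const. Qed.

Lemma embed_block al i : embed al i = embed al (blkstart (blk i)).
Proof. by rewrite /embed blk_start. Qed.

End Embedding.

(** * The theorem *)

Section Assembly.
Variable R : realType.
Variables (E : set (nat -> R)) (L : (nat -> R) -> R).
Hypothesis EL : seq_space E L.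
Let fs : fatou_seminorm E L := EL.
Let Y : completeNormedModType R := bs_type (Yspace EL).
Implicit Types (y : Y) (a : nat -> R).

Definition Yval (y : Y) : nat -> R := bs_val y.
Definition Ymk a (Ya : Ydom E a) : Y := @bs_mk R (Yspace EL) a Ya.

Arguments Yval : simpl never.

Lemma YvalP y : Ydom E (Yval y). Proof. exact: (@bs_valP R (Yspace EL) y). Qed.
Lemma YvalD y y' : Yval (y + y') = Yval y + Yval y'. Proof. by []. Qed.
Lemma YvalB y y' : Yval (y - y') = Yval y - Yval y'. Proof. by []. Qed.
Lemma YvalZ (r : R) y : Yval (r *: y) = r *: Yval y. Proof. by []. Qed.
Lemma Yval0 : Yval 0 = 0. Proof. by []. Qed.
Lemma Yval_inj : injective Yval. Proof. exact: bs_val_inj. Qed.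
Lemma YnormE y : `|y| = Ynorm L (Yval y). Proof. by []. Qed.

Lemma Yval_expansion a (e : nat -> Y) n :
  Yval (expansion a e n) = \sum_(i < n) a i *: Yval (e i).
Proof.
rewrite expansionE; elim: n => [|n IH]; first by rewrite !big_ord0.
by rewrite !big_ord_recr/= YvalD IH YvalZ.
Qed.

Lemma Ycvg_coord (u : nat -> Y) y i : u @ \oo --> y -> Yval (u n) i @[n --> \oo] --> Yval y i.
Proof.
move=> /cvgrPdist_le h; apply/cvgrPdist_le => e /h; apply: filterS => n.
by apply: le_trans; rewrite YnormE YvalB; apply: (Ynorm_coord EL i); rewrite -YvalB; exact: YvalP.
Qed.

Lemma Ycvg (u : nat -> Y) y : Ynorm L (Yval y - Yval (u n)) @[n --> \oo] --> 0 -> u @ \oo --> y.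
Proof.
move=> /cvgr0Pnorm_le h; apply/cvgrPdist_le => e /h; apply: filterS => n.
by apply: le_trans; rewrite YnormE YvalB; exact: ler_norm.
Qed.

Lemma Y_2R : norm_2R Y.
Proof.
move=> x x1 /cvgrPdist_le x2.
apply/cvg_ex; apply: cauchy_seq_cvgn => e e0; apply: (Ynorm_cauchy EL (s := fun k => Yval (x k))) => //.
  by move=> k; split; [exact: YvalP|rewrite -YnormE].
move=> d /x2[[A B] /= [[KA _ hA] [KB _ hB]] h].
exists (maxn KA KB) => k l; rewrite !geq_max => /andP[kA kB] /andP[lA lB].
have := h (k, l) (conj (hA k kA) (hB l lB)); rewrite /= YnormE YvalD ler_norml => /andP[_].
by rewrite lerBlDr addrC -lerBlDr.
Qed.

Definition Yunit i : Y := Ymk (Ydom_unitvec EL i).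

Lemma Yval_unit_expansion a n : Yval (expansion a Yunit n) = head n a.
Proof. by rewrite Yval_expansion headE. Qed.

Lemma Yunit_expansion y : expansion (Yval y) Yunit @ \oo --> y.
Proof.
apply: Ycvg; have := Ynorm_tail_cvg EL (YvalP y).
apply: cvg_trans; apply: near_eq_cvg; apply: nearW => n.
by rewrite Yval_unit_expansion {2}(head_tail n (Yval y)) addrAC subrr add0r.
Qed.

Lemma Yunit_expansion_coord a y : expansion a Yunit @ \oo --> y -> Yval y = a.
Proof.
move=> h; apply/funext => i; have := @Ycvg_coord _ _ i h => h1.
rewrite -(cvg_lim _ h1)//; apply: cvg_lim => //; apply: cvg_near_cst; apply/near_ooP; exists i.+1 => k ik.
by rewrite Yval_unit_expansion /head ik.
Qed.

Lemma Yunit_symmetric : symmetric_basis_with 1 setT Yunit.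
Proof.
split.
  split=> // y _; exists (Yval y); split; first exact: Yunit_expansion.
  by move=> a /Yunit_expansion_coord.
move=> a s sg [tau sgK tauK] b /cvg_ex[y ya].
have va := Yunit_expansion_coord ya; have Ya : Ydom E a by rewrite -va; exact: YvalP.
have [Yp Np] := Ydom_perm EL sgK tauK Ya.
have bE i : `|b i| = `|(a \o sg) i| by rewrite /b normrM normrX normrN1 expr1n mul1r.
have Yb : Ydom E b by apply: (Ydom_ideal EL Yp) => i; rewrite bE.
have Nb : Ynorm L b <= Ynorm L (a \o sg) by apply: (Ynorm_ideal EL Yp) => i; rewrite bE.
have yb : expansion b Yunit @ \oo --> Ymk Yb := @Yunit_expansion (Ymk Yb).
split; first by apply/cvg_ex; exists (Ymk Yb).
have -> : limn (expansion b Yunit) = Ymk Yb by exact: cvg_lim yb.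
have -> : limn (expansion a Yunit) = y by exact: cvg_lim ya.
by rewrite mul1r !YnormE va; exact: le_trans Nb Np.
Qed.

Definition Yproj y : Y := Ymk (Ydom_avg EL (YvalP y)).1.

Lemma Yproj_linear : linear Yproj.
Proof.
by move=> r y y'; apply: Yval_inj; rewrite [LHS]Yavg_linear.
Qed.

(** The range of the averaging projection, which is also the closed span of the block vectors. *)
Definition Zblocks : set Y :=
  [set y | forall i, Yval y i = Yval y (blkstart (blk i))].

Lemma Yproj_id y : Zblocks y -> Yproj y = y.
Proof. by move=> Zy; apply: Yval_inj; exact: Yavg_const. Qed.

Lemma Yproj_Zblocks y : Zblocks (Yproj y).
Proof. by move=> i; exact: Yavg_block. Qed.

Lemma Zblocks_closed_subspace : closed_subspace Zblocks.
Proof.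
split; [|by move=> i; rewrite Yval0|by move=> r x y Zx Zy i; rewrite YvalD YvalZ !fctE Zx Zy].
rewrite closedE => y; apply: contra_notP => nZ.
have [i /eqP yi] : exists i, Yval y i <> Yval y (blkstart (blk i)).
  by apply: contrapT => h; apply: nZ => i; apply: contrapT => hi; apply: h; exists i.
set j := blkstart (blk i) in yi.
have d0 : 0 < `|Yval y i - Yval y j| / 2 by rewrite half_gt0// normr_gt0 subr_eq0.
apply/nbhs_ballP; exists (`|Yval y i - Yval y j| / 2) => // z; rewrite -ball_normE/= => yz Zz.
have h k : `|Yval y k - Yval z k| <= `|y - z|.
  by rewrite YnormE YvalB; apply: (Ynorm_coord EL k); rewrite -YvalB; exact: YvalP.
have := h i; have := h j; rewrite (Zz i) -/j => hj hi.
have := ler_normB (Yval y i - Yval z j) (Yval y j - Yval z j).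
rewrite opprB addrA subrK; move: yz; set D := `|Yval y i - _|; lra.
Qed.

Definition Yembed a (Ea : E a) : Y := Ymk (embed_bound EL Ea).1.

Lemma Yval_embed a (Ea : E a) : Yval (Yembed Ea) = embed a. Proof. by []. Qed.

Lemma unit_dom i : E (unitvec R i). Proof. by case: (ss_unit EL i). Qed.

Definition zvec i : Y := Yembed (unit_dom i).

Lemma Yval_zvec_expansion a n : Yval (expansion a zvec n) = embed (head n a).
Proof.
rewrite Yval_expansion headE; elim: n => [|n IH].
  by rewrite !big_ord0; apply/funext => i; rewrite /embed mulr0.
by rewrite !big_ord_recr/= IH [in RHS]addrC embed_linear addrC.
Qed.

Lemma zvec_expansion a y : E a -> Yval y = embed a -> expansion a zvec @ \oo --> y.
Proof.
move=> Ea ya; apply: Ycvg.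
have h : 17%:R * L (tail n a) @[n --> \oo] --> 0.
  rewrite -[X in _ --> X](mulr0 17%:R); apply: cvgM; first exact: cvg_cst.
  exact: (ss_tail EL Ea).
apply: (squeeze_cvgr _ (cvg_cst 0) h); apply: nearW => n.
have -> : Yval y - Yval (expansion a zvec n) = embed (tail n a).
  by rewrite ya Yval_zvec_expansion -embedB {1}(head_tail n a) addrAC subrr add0r.
have [Ye ->] := embed_bound EL (ss_domtail EL n Ea).
by rewrite (Ynorm_ge0 EL).
Qed.

Lemma zvec_expansion_coord a y : expansion a zvec @ \oo --> y -> Yval y = embed a.
Proof.
move=> h; apply/funext => i; have := @Ycvg_coord _ _ i h => h1.
rewrite -(cvg_lim _ h1)//; apply: cvg_lim => //; apply: cvg_near_cst; apply/near_ooP; exists (blk i).+1 => k ik.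
by rewrite Yval_zvec_expansion /embed /head ik.
Qed.

Lemma Zblocks_unembed y : Zblocks y -> E (unembed (Yval y)).
Proof. by move=> Zy; case: (unembed_bound EL (YvalP y) Zy). Qed.

Lemma zvec_unconditional : unconditional_basis_with 1 Zblocks zvec.
Proof.
split.
  split=> [n i|y Zy]; first exact: embed_block.
  exists (unembed (Yval y)); split.
    by apply: zvec_expansion; [exact: Zblocks_unembed|rewrite unembedK].
  by move=> a /zvec_expansion_coord ->; rewrite embedK.
move=> a s b /cvg_ex[y ya]; have va := zvec_expansion_coord ya.
have Ea : E a.
  rewrite -(embedK a) -va; apply: Zblocks_unembed => i; rewrite va; exact: embed_block.
have bE i : `|b i| = `|a i| by rewrite /b normrM normrX normrN1 expr1n mul1r.
have Eb : E b by apply: (fs_domP fs Ea) => i; rewrite bE.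
have yb : expansion b zvec @ \oo --> Yembed Eb by exact: zvec_expansion.
split; first by apply/cvg_ex; exists (Yembed Eb).
have -> : limn (expansion b zvec) = Yembed Eb by exact: cvg_lim yb.
have -> : limn (expansion a zvec) = y by exact: cvg_lim ya.
rewrite mul1r !YnormE.
apply: (Ynorm_ideal EL (YvalP y)) => i; rewrite va.
by rewrite Yval_embed /embed normrM bE -normrM.
Qed.

Lemma Zblocks_one_complemented : one_complemented Zblocks.
Proof.
right; exists (HB.pack_for {linear Y -> Y} Yproj (GRing.isLinear.Build _ _ _ _ Yproj Yproj_linear)).
have Pn y : `|Yproj y| <= `|y| by rewrite !YnormE; case: (Ydom_avg EL (YvalP y)).
split=> /=.
- by move=> y; apply: Yproj_id; exact: Yproj_Zblocks.
- apply/seteqP; split=> [_ [y _ <-]|y Zy]; first exact: Yproj_Zblocks.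
  by exists y => //; exact: Yproj_id.
apply/eqP; rewrite eq_le; apply/andP; split.
  apply: ge_ereal_sup => _ [y /= y1 <-]; rewrite lee_fin; exact: le_trans (Pn y) y1.
(* A nonzero vector fixed by the projection, so that its norm is 1 and not merely at most 1. *)
pose z := zvec 0; have Zz : Zblocks z by move=> i; exact: embed_block.
have z0 : `|z| != 0.
  rewrite normr_eq0; apply/eqP => h; have := congr1 (fun y => Yval y (blkstart 0)) h.
  rewrite /= Yval_embed /embed blk_start /unitvec eqxx mulr1 Yval0; apply/eqP.
  by rewrite lt0r_neq0// lam_gt0.
pose w := `|z|^-1 *: z; have Zw : Zblocks w by move=> i; rewrite YvalZ !fctE Zz.
have w1 : `|w| = 1 by rewrite normrZ normfV normr_id mulVf.
apply: ereal_sup_ubound; exists w => /=; first by rewrite w1.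
by rewrite Yproj_id// w1.
Qed.

(** * The isomorphism with [X] *)

Section Iso.
Variables (X : completeNormedModType R) (e : nat -> X) (K : R).
Hypothesis e1 : forall n, `|e n| = 1.
Hypothesis K1 : 1 <= K.
Hypothesis eK : unconditional_basis_with K setT e.
Hypothesis X_reflexive : reflexive_space X.
Hypothesis EX : E = Xdom e.
Hypothesis LX : L = Xnorm e.

Let coordE x : E (coord eK x). Proof. by rewrite EX; case: (Xnorm_coord K1 eK x). Qed.

Definition isoT (x : X) : Y := Yembed (coordE x).

Lemma isoT_linear : linear isoT.
Proof.
by move=> r x y; apply: Yval_inj; rewrite /isoT YvalD YvalZ !Yval_embed coord_linear embed_linear.
Qed.

Lemma isomorphic_Zblocks : isomorphic_onto X Zblocks.
Proof.
(* Averaging first defines the inverse on all of [Y], where it is Lipschitz with constant 1. *)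
have /choice[S hS] : forall y : Y, exists x, coord eK x = unembed (Yval (Yproj y)).
  move=> y; apply: (Xdom_coord e1 K1 eK X_reflexive); rewrite -EX.
  exact: Zblocks_unembed (Yproj_Zblocks y).
exists (HB.pack_for {linear X -> Y} isoT (GRing.isLinear.Build _ _ _ _ isoT isoT_linear)), S.
have TZ x : Zblocks (isoT x) by move=> i; exact: embed_block.
have TS y : Zblocks y -> isoT (S y) = y.
  by move=> Zy; apply: Yval_inj; rewrite /isoT Yval_embed hS Yproj_id// unembedK.
split=> /=.
- apply: (@lipschitz_cts _ _ _ _ (17%:R * K ^+ 2)) => x y.
  rewrite YnormE YvalB /isoT !Yval_embed -embedB -coordB.
  have [_ /le_trans] := embed_bound EL (coordE (x - y)); apply.
  by rewrite -mulrA ler_wpM2l// LX; case: (Xnorm_coord K1 eK (x - y)).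
- apply/seteqP; split=> [_ [x _ <-]//|y Zy]; exists (S y) => //; exact: TS.
- move=> x; apply: (coord_inj (eK := eK)); rewrite hS Yproj_id//; exact: embedK.
apply: continuous_subspaceT; apply: (@lipschitz_cts _ _ _ _ 1) => y y'; rewrite mul1r.
apply: (le_trans (norm_le_Xnorm K1 eK _)); rewrite coordB !hS -unembedB -LX.
have Zd : Zblocks (Yproj y - Yproj y').
  by case: Zblocks_closed_subspace => _ _ h; rewrite addrC -scaleN1r; apply: h; exact: Yproj_Zblocks.
have [_ /le_trans] := unembed_bound EL (YvalP _) Zd; rewrite YvalB; apply.
rewrite -YvalB -YnormE (_ : Yproj y - Yproj y' = Yproj (y - y')).
  by rewrite !YnormE; case: (Ydom_avg EL (YvalP (y - y'))).
by rewrite [y - y']addrC -(scaleN1r y') Yproj_linear scaleN1r addrC.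
Qed.

End Iso.
End Assembly.

(** Uniqueness of the expansion of 0 makes every basis vector nonzero. Normalisation is what yields
    [ss_coord] and [ss_unit] with constant 1. *)
Lemma unconditional_basis_normalized (R : realType) (X : normedModType R) (e : nat -> X) :
  unconditional_basis setT e ->
  exists (e' : nat -> X) (K : R), [/\ forall n, `|e' n| = 1, 1 <= K & unconditional_basis_with K setT e'].
Proof.
move=> [K K1 [[_ sb] ub]].
have e0 n : `|e n| != 0.
  rewrite normr_eq0; apply/eqP => en0.
  have exp0 (a : nat -> R) : (forall i, i != n -> a i = 0) -> expansion a e @ \oo --> (0 : X).
    move=> an; apply: cvg_near_cst; apply: nearW => k; rewrite expansionE big1// => i _.
    by have [->|h] := eqVneq (i : nat) n; rewrite ?en0 ?scaler0// an// scale0r.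
  have [a [_ au]] := sb 0 I.
  have d0 i : i != n -> (i == n)%:R = 0 :> R by move=> /negbTE ->.
  have := congr1 (@^~ n) (au _ (exp0 _ d0)).
  rewrite (au _ (exp0 (fun=> 0) (fun _ _ => erefl))) /= eqxx => /esym/eqP.
  by rewrite oner_eq0.
pose e' n := `|e n|^-1 *: e n.
have e'E (a : nat -> R) : expansion a e' = expansion (fun n => a n / `|e n|) e.
  by apply/funext => n; rewrite !expansionE; apply: eq_bigr => i _; rewrite scalerA.
exists e', K; split=> //; first by move=> n; rewrite normrZ normfV normr_id mulVf.
split; last first.
  move=> a s /=; rewrite !e'E => /(ub _ s) /=.
  by rewrite (_ : (fun n => _ * (_ / _)) = fun n => (-1) ^+ s n * a n / `|e n|)//;
    apply/funext => n; rewrite mulrA.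
split=> // x _; have [a [ax au]] := sb x I; exists (fun n => a n * `|e n|); split.
  by rewrite e'E (_ : (fun n => _) = a)//; apply/funext => n; rewrite mulfK.
move=> b; rewrite e'E => /au ->; apply/funext => n; by rewrite divfK.
Qed.

Theorem theorem3p3 (R : realType) (X : completeNormedModType R)
    (X_reflexive : reflexive_space X)
    (X_basis : exists e : nat -> X, unconditional_basis setT e) :
  exists (Y : completeNormedModType R) (Z : set Y),
    norm_2R Y /\
    (exists y : nat -> Y, symmetric_basis_with 1 setT y) /\
    closed_subspace Z /\
    one_complemented Z /\
    isomorphic_onto X Z /\
    (exists z : nat -> Y, unconditional_basis_with 1 Z z).
Proof.
have [e0 /unconditional_basis_normalized[e [K [e1 K1 eK]]]] := X_basis.
pose EL := seq_space_X e1 K1 eK X_reflexive.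
exists (bs_type (Yspace EL)), (@Zblocks _ _ _ EL).
split; first exact: Y_2R.
split; first by exists (Yunit EL); exact: Yunit_symmetric.
split; first exact: Zblocks_closed_subspace.
split; first exact: Zblocks_one_complemented.
split; first exact: (isomorphic_Zblocks EL e1 K1 eK X_reflexive).
by exists (zvec EL); exact: zvec_unconditional.
Qed.
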